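(* Let $f$ be a (real) quasi-homogeneous polynomial on $\mathbb R^n$ with weights $w=(w_1,\dots,w_n)\in\mathbb Z_{>0}^n$ and weighted degree $d$, having an isolated critical point at the origin and depending on every variable, and let $\kappa>0$, $K=|f|^{-\kappa}$. Write $|w|=w_1+\cdots+w_n$, $w_{\max}=\max_iw_i$, let $Z_{\mathbb R}(f)$ be the real zero set of $f$ near the origin, and let $p^*(\kappa)$ be the exact gradient-integrability threshold of $K$. Then: (i) if $Z_{\mathbb R}(f)=\{0\}$, $$p^*(\kappa)=\frac{|w|}{\kappa d+w_{\max}};$$ (ii) if $Z_{\mathbb R}(f)\supsetneq\{0\}$, $$p^*(\kappa)=\min\Bigl(\frac{|w|}{\kappa d+w_{\max}},\ \frac1{\kappa+1}\Bigr).$$ In either case $\mathrm{rlct}_0(f)\le|w|/d$, so $\overline p(\kappa):=\mathrm{rlct}_0(f)/(\kappa+1)\le(|w|/d)/(\kappa+1)$, and the bound $\overline p(\kappa)\le p^*(\kappa)$ is strict in case (i), and in case (ii) whenever $|w|/(\kappa d+w_{\max})<1/(\kappa+1)$.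
   Context: $f$ is quasi-homogeneous with weights $w$ and weighted degree $d$ if $f(\varepsilon^{w_1}x_1,\dots,\varepsilon^{w_n}x_n)=\varepsilon^df(x)$ for all $\varepsilon>0$. The exact threshold $p^*(\kappa)$ is characterised by: for $p>0$, $\nabla K\in L^p_{\mathrm{loc}}$ near the origin if and only if $p<p^*(\kappa)$ (where $\nabla K$ is the pointwise gradient off $\{f=0\}$, and $L^p_{\mathrm{loc}}$ near the origin means $|\nabla K|^p$ is integrable on some neighborhood of $0$). Equivalently, $p^*(\kappa)=\min_i\frac{a_i+1}{(\kappa+1)\nu_i-M_i}$, where $\nu_i,M_i,a_i$ are respectively the vanishing order of $f$, the vanishing order of the Jacobian ideal $(\partial_1f,\dots,\partial_nf)$, and the order of vanishing of the Jacobian determinant of $\pi$, along the real components $E_i$ of the total transform of $(f=0)$ meeting $\pi^{-1}(0)$ (exceptional and strict-transform components alike) in a real log-resolution $\pi$ of $f$ together with its Jacobian ideal. The real log-canonical threshold is $\mathrm{rlct}_0(f):=\sup\{c>0:\ |f|^{-c}\in L^1_{\mathrm{loc}}\text{ near }0\}$. *)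

(* Defs.v *)
From HB Require Import structures.
From mathcomp Require Import all_boot all_order all_algebra.
From mathcomp Require mpoly.
From mathcomp Require Import all_classical all_reals all_analysis.

Set Implicit Arguments.
Unset Strict Implicit.
Unset Printing Implicit Defensive.
Import Order.TTheory GRing.Theory Num.Theory.
Import numFieldNormedType.Exports.
Local Open Scope classical_set_scope.
Local Open Scope ring_scope.

Definition rV_display : measure_display.
Proof. exact: default_measure_display. Qed.

Section measurable_rV.
Context {R : realType} {n : nat}.

Let coords : 'I_n -> 'rV[R]_n -> measurableTypeR R := fun i x => x ord0 i.

Let rV_set0 : g_sigma_preimage coords set0.
Proof. exact: sigma_algebra0. Qed.

Let rV_setC A : g_sigma_preimage coords A -> g_sigma_preimage coords (~` A).
Proof. exact: sigma_algebraC. Qed.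

Let rV_bigcup (F : _^nat) : (forall i, g_sigma_preimage coords (F i)) ->
  g_sigma_preimage coords (\bigcup_i (F i)).
Proof. exact: sigma_algebra_bigcup. Qed.

(* The sigma-algebra generated by the coordinates, i.e. the Borel sets. *)
HB.instance Definition _ := @isMeasurable.Build
  rV_display
  'rV[R]_n (g_sigma_preimage coords) rV_set0 rV_setC rV_bigcup.

Lemma measurable_coord (i : 'I_n) :
  measurable_fun [set: 'rV[R]_n] (fun x => x ord0 i : measurableTypeR R).
Proof.
move=> _ Y mY; rewrite setTI; apply: sub_sigma_algebra => /=.
rewrite -bigcup_seq/=; exists i => /=; first by rewrite mem_index_enum.
by exists Y => //; rewrite setTI.
Qed.

Lemma measurable_fun_coordP d (T : measurableType d) (f : T -> 'rV[R]_n) :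
  measurable_fun setT f <->
  forall i, measurable_fun setT (fun t => f t ord0 i : measurableTypeR R).
Proof.
split=> [mf i|mf]; first exact: (measurableT_comp (measurable_coord i) mf).
have : g_sigma_preimage (fun i => coords i \o f) `<=` measurable.
  apply: smallest_sub; first exact: sigma_algebra_measurable.
  rewrite -bigcup_seq; apply: bigcup_sub => i _.
  by move=> A [B mB <-]; exact: mf.
rewrite (@g_sigma_preimage_comp _ _ n _ coords _ f) => h _ A mA.
by apply: h; exists A.
Qed.

End measurable_rV.


Section lebesgue_rV_step.
Local Open Scope ereal_scope.
Context {R : realType} {n : nat}.
Variable mu : {sigma_finite_measure set 'rV[R]_n -> \bar R}.

Definition cons_rV (z : measurableTypeR R * 'rV[R]_n) : 'rV[R]_n.+1 :=
  row_mx (const_mx z.1 : 'rV[R]_1) z.2.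

Lemma cons_rV0 z : cons_rV z ord0 ord0 = z.1.
Proof.
rewrite /cons_rV (_ : ord0 = lshift n (ord0 : 'I_1)); last exact/val_inj.
by rewrite (row_mxEl (const_mx z.1 : 'rV[R]_1)) mxE.
Qed.

Lemma cons_rVS z i : cons_rV z ord0 (lift ord0 i) = z.2 ord0 i.
Proof.
rewrite /cons_rV (_ : lift ord0 i = rshift 1 i); last exact/val_inj.
by rewrite (row_mxEr (const_mx z.1 : 'rV[R]_1)).
Qed.

Lemma measurable_cons_rV : measurable_fun setT cons_rV.
Proof.
apply/measurable_fun_coordP => i; case: (unliftP ord0 i) => [j ->|->].
  under eq_fun do rewrite cons_rVS.
  exact: (measurableT_comp (measurable_coord j) measurable_snd).
by under eq_fun do rewrite cons_rV0; exact: measurable_fst.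
Qed.

HB.instance Definition _ :=
  isMeasurableFun.Build _ _ _ _ cons_rV measurable_cons_rV.

Definition lebesgue_step : set 'rV[R]_n.+1 -> \bar R :=
  pushforward (lebesgue_measure \x mu) cons_rV.

Let step0 : lebesgue_step set0 = 0.
Proof. by rewrite /lebesgue_step /pushforward preimage_set0 measure0. Qed.

Let step_ge0 A : 0 <= lebesgue_step A.
Proof. exact: measure_ge0. Qed.

Let step_sigma_additive : semi_sigma_additive lebesgue_step.
Proof. exact: measure_semi_sigma_additive. Qed.

HB.instance Definition _ := isMeasure.Build _ _ _ lebesgue_step
  step0 step_ge0 step_sigma_additive.

Let step_sigma_finite : sigma_finite setT lebesgue_step.
Proof.
pose split_rV (x : 'rV[R]_n.+1) : measurableTypeR R * 'rV[R]_n :=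
  (x ord0 ord0, (\row_i x ord0 (lift ord0 i))%R).
have consK : cancel cons_rV split_rV.
  move=> [a y]; rewrite /split_rV cons_rV0; congr pair.
  by apply/rowP => i; rewrite mxE cons_rVS.
have msplit : measurable_fun setT split_rV.
  apply/measurable_fun_pairP; split; first exact: measurable_coord.
  apply/measurable_fun_coordP => i /=.
  by under eq_fun do rewrite mxE; exact: measurable_coord.
have [F FT Ffin] : sigma_finite setT (lebesgue_measure \x mu).
  have /sigma_finiteP[F [TF ndF Foo]] := sigma_finiteT (@lebesgue_measure R).
  have /sigma_finiteP[G [TG ndG Goo]] := sigma_finiteT mu.
  exists (fun k => F k `*` G k) => [|k].
    rewrite -setXTT TF TG predeqE => -[x y]; split.
      move=> [/= [k _ Fkx] [l _ Gly]]; exists (maxn k l) => //; split.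
      - by move: x Fkx; exact/subsetPset/ndF/leq_maxl.
      - by move: y Gly; exact/subsetPset/ndG/leq_maxr.
    by move=> [k _ []/= ? ?]; split; exists k.
  have [? ?] := Foo k; have [? ?] := Goo k.
  split; first exact: measurableX.
  by rewrite product_measure1E// lte_mul_pinfty// ge0_fin_numE.
exists (fun k => split_rV @^-1` F k).
  by rewrite -preimage_bigcup -FT preimage_setT.
move=> k; have [mF Foo] := Ffin k; split.
  by rewrite -[X in measurable X]setTI; exact: msplit.
rewrite /lebesgue_step /pushforward -comp_preimage.
by rewrite (_ : split_rV \o cons_rV = id) ?preimage_id//; apply/funext.
Qed.

HB.instance Definition _ := Measure_isSigmaFinite.Build _ _ _ lebesgue_step
  step_sigma_finite.

End lebesgue_rV_step.

Section lebesgue_rV.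
Context {R : realType}.

(* The library has no Lebesgue measure on R^n. Here R^(n+1) is R * R^n with the
   product measure; [lebesgue_rV_box] computes the measure of boxes, which
   determines it. *)
Fixpoint lebesgue_rV n : {sigma_finite_measure set 'rV[R]_n -> \bar R} :=
  match n with
  | 0 => \d_(0 : 'rV[R]_0)
  | n'.+1 => lebesgue_step (lebesgue_rV n')
  end.

End lebesgue_rV.

Lemma lebesgue_rV_box (R : realType) n (A : 'I_n -> set (measurableTypeR R)) :
  (forall i, measurable (A i)) ->
  lebesgue_rV n [set x : 'rV[R]_n | forall i, A i (x ord0 i)] =
  (\prod_(i < n) lebesgue_measure (A i))%E.
Proof.
elim: n A => [|n IHn] A mA.
  rewrite big_ord0 (_ : [set _ | _] = setT); first by rewrite /= diracT.
  by apply/seteqP; split=> // x _ [].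
pose B := [set y : 'rV[R]_n | forall i, A (lift ord0 i) (y ord0 i)].
rewrite big_ord_recl -(IHn (fun i => A (lift ord0 i)))//= -/B.
have mB : measurable B.
  rewrite (_ : B = \bigcap_(i in [set: 'I_n])
      (fun y : 'rV[R]_n => y ord0 i : measurableTypeR R) @^-1`
        A (lift ord0 i)); last first.
    by apply/seteqP; split=> [y By i _|y By i]; [exact: By|exact: By].
  apply: fin_bigcap_measurable => // i _.
  by rewrite -[X in measurable X]setTI; exact: measurable_coord.
rewrite -product_measure1E//; rewrite /lebesgue_step /pushforward.
congr (product_measure1 _ _ _).
apply/seteqP; split=> -[a y] /=.
  move=> Aay; split=> [|i]; first by have := Aay ord0; rewrite cons_rV0.
  by have := Aay (lift ord0 i); rewrite cons_rVS.
move=> [Aa By] i; case: (unliftP ord0 i) => [j ->|->].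
  by rewrite cons_rVS; exact: By.
by rewrite cons_rV0.
Qed.

Section gradient.
Context {R : realType} {n : nat}.
Implicit Types g : 'rV[R]_n -> R.

Definition grad g (x : 'rV[R]_n) : 'rV[R]_n :=
  \row_i 'D_(delta_mx ord0 i) (g : 'rV[R]_n -> R^o) x.

(* The norm carried by ['rV[R]_n] is the sup norm. *)
Definition enorm (v : 'rV[R]_n) : R := Num.sqrt (\sum_i v ord0 i ^+ 2).

Definition isolated_critical_point g (x0 : 'rV[R]_n) : Prop :=
  grad g x0 = 0 /\ \forall x \near x0^', grad g x != 0.

Definition depends_on g (i : 'I_n) : Prop :=
  exists x y : 'rV[R]_n,
    (forall j, j != i -> x ord0 j = y ord0 j) /\ g x <> g y.

Definition quasi_homogeneous g (w : 'I_n -> nat) (d : nat) : Prop :=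
  forall eps : R, 0 < eps -> forall x : 'rV[R]_n,
    g (\row_i (eps ^+ w i * x ord0 i)) = eps ^+ d * g x.

Definition zeros g : set 'rV[R]_n := [set x | g x = 0].

(* The germ at the origin of the zero set is, respectively strictly contains,
   the germ of the origin. *)
Definition zeros_trivial g : Prop :=
  exists2 U, nbhs (0 : 'rV[R]_n) U & zeros g `&` U = [set 0].

Definition zeros_nontrivial g : Prop :=
  forall U, nbhs (0 : 'rV[R]_n) U -> [set 0] `<` zeros g `&` U.

Definition integrable_near0 (D : set 'rV[R]_n) (h : 'rV[R]_n -> \bar R) :
    Prop :=
  exists U, [/\ nbhs (0 : 'rV[R]_n) U, measurable U &
    (lebesgue_rV n).-integrable (U `&` D) h].

(* At a zero of [g] the value is [0], a convention that is never used: the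
   derivative of [neg_power g kappa] is only taken on the open set [g != 0]. *)
Definition neg_power g (kappa : R) (x : 'rV[R]_n) : R := `|g x| `^ (- kappa).

Definition grad_Lp_near0 g (kappa p : R) : Prop :=
  integrable_near0 (~` zeros g)
    (fun x => (enorm (grad (neg_power g kappa) x) `^ p)%:E).

Definition is_grad_threshold g (kappa pstar : R) : Prop :=
  forall p, 0 < p -> (grad_Lp_near0 g kappa p <-> p < pstar).

(* The inverse is taken in the extended reals, where [0^-1 = +oo]: the
   integrand is [+oo] on the zero set of [g]. *)
Definition rlct0 g : \bar R := ereal_sup
  [set c%:E | c in [set c : R | 0 < c /\
    integrable_near0 setT (fun x => ((`|g x| `^ c)%:E^-1)%E)]].

End gradient.

Definition peval (R : realType) n (f : mpoly.mpoly n R) (x : 'rV[R]_n) : R :=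
  mpoly.meval (fun i => x ord0 i) f.

Definition wsum n (w : 'I_n -> nat) : nat := (\sum_(i < n) w i)%N.

Definition wmax n (w : 'I_n -> nat) : nat := (\max_(i < n) w i)%N.

(* Main.v *)
(* The dilations D_eps x = (eps^w_i x_i) scale Lebesgue measure by eps^|w|, and
   the i-th partial derivative of K = |f|^-kappa by eps^-(kappa d + w_i).
   Cutting the unit cube into the dyadic shells D_{2^-k} S, the integral of
   |grad K|^p near 0 is a geometric series which converges iff
   p (kappa d + w_max) < |w|, times the integral over the single shell S, whose
   closure is compact and avoids 0. There grad f does not vanish, so |grad K|^p
   is comparable to |f|^(-p (kappa + 1)) near the zeros of f, and the measure of
   {|f| < r} is comparable to r, which gives the condition p (kappa + 1) < 1 as
   soon as f has a zero other than 0. The same argument with |f|^-c in place of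
   |grad K|^p bounds the log-canonical threshold by |w| / d and, when f has a
   zero other than 0, by 1. Finally w_max < d: if w_i >= d, then
   d_i f (x) = eps^(w_i - d) d_i f (D_eps x) tends to 0 with eps, as
   d_i f (0) = 0, whereas f depends on x_i. *)
Require Import Defs.
From mathcomp Require Import all_boot all_order all_algebra.
From mathcomp Require mpoly.
From mathcomp Require Import all_classical all_reals all_analysis.
From mathcomp Require Import measurable_realfun.
From mathcomp Require Import ring lra.
Import -(notations) mpoly.
Import Order.TTheory GRing.Theory Num.Theory.
Import numFieldNormedType.Exports.
Local Open Scope classical_set_scope.
Local Open Scope ring_scope.

Set Implicit Arguments.
Unset Strict Implicit.
Unset Printing Implicit Defensive.

(** Comparing the measure of {|f| < r} with r uses no implicit function and no change of
    coordinates, only translation invariance and the mean value theorem along one axis e_j with d_j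
    f != 0: disjoint translates give the upper bound, covering translates the lower one. The
    components of grad K scale with different exponents kappa d + w_i, so |grad K|^p satisfies only
    an inequality under contractions. That yields convergence with the worst exponent; for
    divergence the gradient is replaced by one partial derivative of maximal weight, which scales
    exactly. Dependence of f on that variable provides a point where f and this derivative are both
    nonzero. The borderline exponents diverge as well: near a zero of f this contradicts the
    continuity of a finite integral along shrinking sets, at the origin it contradicts scaling. Real
    powers take a conventional finite value at zeros of f, so lower bounds are taken on {0 < |f| <
    r}. Finally pbar <= p* splits along the terms of the minimum: rlct <= |w| / d and w_max < d
    handle the first, rlct <= 1 the second. *)

Lemma pushforward_is_measure d d' (T1 : measurableType d)
    (T2 : measurableType d') (R : realType) (m : {measure set T1 -> \bar R})
    (f : T1 -> T2) : measurable_fun setT f ->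
  exists m' : {measure set T2 -> \bar R}, forall A, m' A = m (f @^-1` A).
Proof.
by move=> mf; unshelve eexists (pushforward m f : {measure set T2 -> \bar R}).
Qed.

(** * Lebesgue measure under diagonal affine maps *)

Section lebesgue_rV_affine.
Context {R : realType}.

Local Notation vol n := (lebesgue_rV n : {measure set 'rV[R]_n -> \bar R}).

Definition box n (A : 'I_n -> set (measurableTypeR R)) : set 'rV[R]_n :=
  [set x | forall i, A i (x ord0 i)].

Lemma measurable_box n (A : 'I_n -> set (measurableTypeR R)) :
  (forall i, measurable (A i)) -> measurable (box A).
Proof.
move=> mA; rewrite (_ : box A = \bigcap_(i in [set: 'I_n])
    (fun y : 'rV[R]_n => y ord0 i : measurableTypeR R) @^-1` A i); last first.
  by apply/seteqP; split=> [y By i _|y By i]; [exact: By|exact: By].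
apply: fin_bigcap_measurable => // i _.
by rewrite -[X in measurable X]setTI; exact: measurable_coord.
Qed.

Lemma lebesgue_rV_boxE n (A : 'I_n -> set (measurableTypeR R)) :
  (forall i, measurable (A i)) ->
  vol n (box A) = (\prod_(i < n) lebesgue_measure (A i))%E.
Proof. exact: lebesgue_rV_box. Qed.

Lemma lebesgue_rV_box_lty n (A : 'I_n -> set (measurableTypeR R)) :
  (forall i, measurable (A i)) -> (forall i, lebesgue_measure (A i) < +oo)%E ->
  (vol n (box A) < +oo)%E.
Proof.
move=> mA Aoo; rewrite lebesgue_rV_boxE//.
suff /andP[] : (0 <= \prod_(i < n) lebesgue_measure (A i) < +oo)%E by [].
apply: (big_ind (fun x => 0 <= x < +oo)%E) => [|x y /andP[x0 xoo] /andP[y0 yoo]|i _].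
- by rewrite lee01 ltry.
- by rewrite mule_ge0//= lte_mul_pinfty// ge0_fin_numE.
- by rewrite measure_ge0/= Aoo.
Qed.

Let boxes n : set_system 'rV[R]_n :=
  [set B | exists2 A : 'I_n -> set (measurableTypeR R),
     (forall i, measurable (A i)) & B = box A].

(** Boxes form a pi-system generating the sigma-algebra, and the cubes with sides [-k, k] exhaust
    the space with finite measure. *)
Lemma lebesgue_rV_unique n (m : {measure set 'rV[R]_n -> \bar R}) :
  (forall A : 'I_n -> set (measurableTypeR R), (forall i, measurable (A i)) ->
     m (box A) = (\prod_(i < n) lebesgue_measure (A i))%E) ->
  forall B, measurable B -> vol n B = m B.
Proof.
move=> mE; apply: (@measure_unique _ R _ (@boxes n)
    (fun k => box (fun=> `[- k%:R, k%:R]%classic))).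
- apply/seteqP; split; last first.
    apply: smallest_sub; first exact: sigma_algebra_measurable.
    by move=> _ [A mA ->]; exact: measurable_box.
  apply: smallest_sub; first exact: smallest_sigma_algebra.
  rewrite -bigcup_seq; apply: bigcup_sub => i _ _ [A mA <-].
  apply: sub_sigma_algebra.
  (* The preimage of [A] under one coordinate is a box whose other sides are full. *)
  exists (fun j => if j == i then A else setT).
    by move=> j; case: ifP.
  apply/seteqP; split => [x [_ Ax] j|x /(_ i)]; last by rewrite /= eqxx; split.
  by case: eqP => // ->.
- move=> _ _ [A mA ->] [B mB ->]; exists (fun i => A i `&` B i).
    by move=> i; exact: measurableI.
  apply/seteqP; split => [x [Ax Bx] i|x ABx]; first by split; [exact: Ax|exact: Bx].
  by split => i; have [] := ABx i.
- by move=> k; exists (fun=> `[- k%:R, k%:R]%classic).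
- apply/seteqP; split => // x _.
  have [k xk] : exists k : nat, forall i, `|x ord0 i| <= k%:R.
    exists (\sum_i (Num.truncn `|x ord0 i|).+1)%N => i.
    apply: (le_trans (ltW (truncnS_gt _))).
    by rewrite ler_nat (bigD1 i)//= leq_addr.
  by exists k => // i /=; rewrite in_itv/= -ler_norml.
- by move=> _ [A mA ->]; exact: etrans (lebesgue_rV_boxE mA) (esym (mE _ mA)).
- move=> k; apply: lebesgue_rV_box_lty => // i.
  by rewrite lebesgue_measure_itv/=; case: ifPn => // _; rewrite -EFinB ltry.
Qed.

(** The image measure scaled by [a] agrees with Lebesgue measure on half-open intervals, which
    determine it. *)
Let lebesgue_measure_affine (a b : R) (A : set (measurableTypeR R)) :
  0 < a -> measurable A ->
  lebesgue_measure ((fun t : R => a * t + b : measurableTypeR R) @^-1` A) =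
  ((a^-1)%:E * lebesgue_measure A)%E.
Proof.
move=> a0 mA.
have mf : measurable_fun setT (fun t : measurableTypeR R => a * t + b : measurableTypeR R).
  by apply: measurable_funD => //; exact: measurable_funM.
have [m1 m1E] := pushforward_is_measure lebesgue_measure mf.
pose m2 : {measure set (measurableTypeR R) -> \bar R} :=
  mscale (NngNum (ltW a0)) m1.
have m2E B : m2 B = (a%:E * m1 B)%E by [].
have -> : lebesgue_measure A = m2 A.
  apply: lebesgue_measure_unique => // _ [[c d] _ <-] /=.
  rewrite m2E m1E.
  rewrite (_ : _ @^-1` _ = `](c - b) / a, (d - b) / a]%classic); last first.
    apply/seteqP; split => x /=; rewrite !in_itv/= ltr_pdivrMr// ler_pdivlMr//;
    by rewrite ltrBlDr lerBrDr (mulrC x).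
  rewrite [X in _ = (_ * X)%E](lebesgue_measure_itv `](c - b) / a, (d - b) / a]).
  rewrite lebesgue_measure_itv/= !lte_fin ltr_pM2r ?invr_gt0// ltrD2r.
  case: ifPn => _; last by rewrite mule0.
  by rewrite -!EFinB -EFinM; congr EFin; field; rewrite gt_eqF.
by rewrite m2E m1E muleA -EFinM mulVf ?gt_eqF// mul1e.
Qed.

Definition diag_affine n (a b : 'I_n -> R) (x : 'rV[R]_n) : 'rV[R]_n :=
  \row_i (a i * x ord0 i + b i).

Lemma measurable_diag_affine n (a b : 'I_n -> R) :
  measurable_fun setT (diag_affine a b).
Proof.
apply/measurable_fun_coordP => i; under eq_fun do rewrite mxE.
apply: measurable_funD => //; apply: measurable_funM => //.
exact: measurable_coord.
Qed.

(** Scaled by the product of the [a i], the image measure has the right value on boxes, by the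
    one-dimensional case on each side. *)
Lemma lebesgue_rV_diag_affine n (a b : 'I_n -> R) (B : set 'rV[R]_n) :
  (forall i, 0 < a i) -> measurable B ->
  vol n (diag_affine a b @^-1` B) =
  ((\prod_i a i)^-1%:E * vol n B)%E.
Proof.
move=> a0 mB; have pa0 : 0 < \prod_i a i by exact: prodr_gt0.
have [m1 m1E] := pushforward_is_measure (vol n)
  (@measurable_diag_affine _ a b).
pose m2 : {measure set 'rV[R]_n -> \bar R} :=
  mscale (NngNum (ltW pa0)) m1.
have m2E C : m2 C = ((\prod_i a i)%:E * m1 C)%E by [].
have -> : vol n B = m2 B.
  apply: lebesgue_rV_unique => // A mA.
  rewrite m2E m1E.
  rewrite (_ : _ @^-1` _ = box (fun i =>
      (fun t : R => a i * t + b i : measurableTypeR R) @^-1` A i)); last first.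
    by apply/seteqP; split => x Ax i; have := Ax i; rewrite /diag_affine mxE.
  pose P i := (fun t : measurableTypeR R => a i * t + b i : measurableTypeR R)
    @^-1` A i.
  have mP i : measurable (P i).
    rewrite -[X in measurable X]setTI.
    have mf : measurable_fun setT
        (fun t : measurableTypeR R => a i * t + b i : measurableTypeR R).
      by apply: measurable_funD => //; exact: measurable_funM.
    exact: mf.
  rewrite [X in (_ * X)%E = _](lebesgue_rV_boxE mP).
  rewrite -prodEFin -big_split/=; apply: eq_bigr => i _.
  by rewrite lebesgue_measure_affine// muleA -EFinM mulfV ?gt_eqF// mul1e.
by rewrite m2E m1E muleA -EFinM mulVf ?gt_eqF// mul1e.
Qed.

(** The scaled image measure coincides with Lebesgue measure, so integrating against a pushforward
    becomes a change of variables. *)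
Lemma ge0_integral_diag_affine n (a b : 'I_n -> R) (B : set 'rV[R]_n)
    (h : 'rV[R]_n -> \bar R) :
  (forall i, 0 < a i) -> measurable B -> measurable_fun B h ->
  (forall x, B x -> 0 <= h x)%E ->
  (\int[lebesgue_rV n]_(x in B) h x = (\prod_i a i)%:E *
     \int[lebesgue_rV n]_(x in diag_affine a b @^-1` B) h (diag_affine a b x))%E.
Proof.
move=> a0 mB mh h0; have pa0 : 0 < \prod_i a i by exact: prodr_gt0.
have [m1 m1E] := pushforward_is_measure (lebesgue_rV n)
  (@measurable_diag_affine _ a b).
transitivity (\int[mscale (NngNum (ltW pa0)) m1]_(x in B) h x)%E.
  apply: eq_measure_integral => A mA AB.
  rewrite [RHS](_ : _ = ((\prod_i a i)%:E * m1 A)%E)//.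
  rewrite m1E lebesgue_rV_diag_affine//.
  by rewrite muleA -EFinM mulfV ?gt_eqF// mul1e.
rewrite ge0_integral_mscale//=; congr (_ * _)%E.
transitivity (\int[pushforward (lebesgue_rV n) (diag_affine a b)]_(x in B) h x)%E.
  apply: eq_measure_integral => [|mp A mA AB]; last exact: m1E.
  exact: measurable_diag_affine.
rewrite (ge0_integral_pushforward (@measurable_diag_affine _ a b))//.
by move=> x /set_mem; exact: h0.
Qed.

End lebesgue_rV_affine.

(** * Integrals along monotone sequences of sets *)

Section ge0_integral_sequences.
Context d (T : measurableType d) (R : realType) (mu : {measure set T -> \bar R}).
Variable h : T -> \bar R.
Hypothesis mh : measurable_fun setT h.
Hypothesis h0 : (forall x, 0 <= h x)%E.
Local Open Scope ereal_scope.

Let mhS A : measurable_fun A h. Proof. exact: measurable_funTS. Qed.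

Lemma ge0_integral_setD A B : measurable A -> measurable B -> A `<=` B ->
  \int[mu]_(x in B) h x =
  \int[mu]_(x in A) h x + \int[mu]_(x in B `\` A) h x.
Proof.
move=> mA mB AB; rewrite -{1}(setDUK AB) ge0_integral_setU//.
  exact: measurableD.
by apply/disj_setPS; rewrite setDIK.
Qed.

(** Partial sums of a geometric series bound the integral over each [F k], and monotone convergence
    passes the bound to the union. *)
Lemma ge0_integral_geometric_lty (F : (set T)^nat) (a th : R) :
  (forall k, measurable (F k)) -> nondecreasing_seq F ->
  \int[mu]_(x in F 0%N) h x < +oo -> (0 <= th < 1)%R ->
  (forall k, \int[mu]_(x in F k.+1 `\` F k) h x <= (a * th ^+ k)%:E) ->
  \int[mu]_(x in \bigcup_k F k) h x < +oo.
Proof.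
move=> mF ndF F0oo /andP[th0 th1] Fa.
have a0 : (0 <= a)%R.
  by rewrite -lee_fin (le_trans _ (le_trans (Fa 0%N) _)) ?integral_ge0// expr0 mulr1.
have th1' : (0 < 1 - th)%R by rewrite subr_gt0.
have bE : (fine (\int[mu]_(x in F 0%N) h x))%:E = \int[mu]_(x in F 0%N) h x.
  by rewrite fineK// ge0_fin_numE// integral_ge0.
set b := fine _ in bE.
have Fk k : \int[mu]_(x in F k) h x <= (b + a * ((1 - th ^+ k) / (1 - th)))%:E.
  elim: k => [|k IH]; first by rewrite expr0 subrr mul0r mulr0 addr0 bE.
  rewrite (@ge0_integral_setD (F k) (F k.+1))//; last first.
    exact/subsetPset/ndF.
  apply: (le_trans (leeD IH (Fa k))); rewrite -EFinD lee_fin.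
  by rewrite le_eqVlt; apply/orP; left; apply/eqP; rewrite exprS; field; rewrite gt_eqF.
have cF := ge0_nondecreasing_set_cvg_integral (mu := mu) ndF mF (fun i => @mhS (F i))
  (fun i x _ => h0 x).
rewrite -(cvg_lim _ cF)//.
apply: (@le_lt_trans _ _ (b + a / (1 - th))%:E); last by rewrite ltry.
apply: lime_le; first by apply/cvg_ex; exists (\int[mu]_(x in \bigcup_k F k) h x).
apply: nearW => k; apply: (le_trans (Fk k)); rewrite lee_fin lerD2l.
by rewrite ler_wpM2l// ler_pdivrMr// mulVf ?gt_eqF// gerBl exprn_ge0.
Qed.

(** Continuity of a finite integral along sets decreasing to the empty set; it later excludes the
    borderline exponent near a zero of g. *)
Lemma ge0_integral_shrinking (S : (set T)^nat) (c : R) :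
  (forall k, measurable (S k)) -> nonincreasing_seq S ->
  \bigcap_k S k = set0 -> \int[mu]_(x in S 0%N) h x < +oo -> (0 < c)%R ->
  ~ forall k, c%:E <= \int[mu]_(x in S k) h x.
Proof.
move=> mS niS S0 Soo c0 cS.
have SS k : S k `<=` S 0%N by apply/subsetPset/niS.
pose F k := S 0%N `\` S k.
have mF k : measurable (F k) by exact: measurableD.
have ndF : nondecreasing_seq F.
  by move=> i j ij; apply/subsetPset; apply: setDS; apply/subsetPset/niS.
have FS : \bigcup_k F k = S 0%N.
  apply/seteqP; split=> [x [k _ []]//|x Sx].
  have [k nSx] : exists k, ~ S k x.
    by apply/existsNP => aS; have : (\bigcap_k S k) x by []; rewrite S0.
  by exists k.
have cF := ge0_nondecreasing_set_cvg_integral (mu := mu) ndF mF (fun i => @mhS (F i))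
  (fun i x _ => h0 x).
have Sfin : \int[mu]_(x in S 0%N) h x \is a fin_num.
  by rewrite ge0_fin_numE// integral_ge0.
(* Each [F k] carries at most the total minus [c], and the [F k] increase to [S 0%N]. *)
suff : \int[mu]_(x in S 0%N) h x <= \int[mu]_(x in S 0%N) h x - c%:E.
  move: Sfin; case: (\int[mu]_(x in S 0%N) h x) => // r _.
  by rewrite -EFinB lee_fin lerDl oppr_ge0 leNgt c0.
rewrite -{1}FS -(cvg_lim _ cF)//.
apply: lime_le; first by apply/cvg_ex; exists (\int[mu]_(x in \bigcup_k F k) h x).
apply: nearW => k; rewrite leeBrDr// addeC.
by rewrite (@ge0_integral_setD (S k) (S 0%N))// leeD2r.
Qed.

End ge0_integral_sequences.

(** * Partial derivatives and the mean value theorem along the axes *)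

Section partial_derivatives.
Context {R : realType} {n : nat}.
Implicit Types (g : 'rV[R]_n -> R) (dg : 'I_n -> 'rV[R]_n -> R) (x : 'rV[R]_n).

Local Notation e i := (delta_mx ord0 i : 'rV[R]_n).

(** Only derivatives along the coordinate axes are recorded: every estimate below moves along one
    axis at a time. *)
Definition has_partials g dg : Prop :=
  forall i x, is_derive x (e i) (g : 'rV[R]_n -> R^o) (dg i x).

Lemma has_partials_line g dg i x t : has_partials g dg ->
  is_derive (t : R) 1 ((fun s => g (s *: e i + x)) : R -> R^o)
    (dg i (t *: e i + x)).
Proof.
move=> /(_ i (t *: e i + x)) [gd gv].
have E : (fun h : R => h^-1 *: (((fun s => g (s *: e i + x)) \o shift t) (h *: 1) -
                     g (t *: e i + x) : R^o)) =
    (fun h : R => h^-1 *: (((g : 'rV[R]_n -> R^o) \o shift (t *: e i + x)) (h *: e i) -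
                     g (t *: e i + x))).
  apply/funext => h /=; congr (_ *: (g _ - _)).
  have -> : h *: (1 : R^o) = h by exact: mulr1.
  by rewrite scalerDl addrA.
by apply: DeriveDef; rewrite /derivable /derive E.
Qed.

(** The intermediate point is located only by |s| <= |t|, which treats both signs of t at once and
    is enough to keep it inside a ball. *)
Lemma has_partials_MVT g dg i x (t : R) : has_partials g dg ->
  exists2 s, `|s| <= `|t| & g (t *: e i + x) - g x = dg i (s *: e i + x) * t.
Proof.
move=> gdg; pose F : R -> R := fun s => g (s *: e i + x).
have dF s := has_partials_line i x s gdg.
have cF : continuous F.
  move=> s; have [ds _] := dF s.
  exact/differentiable_continuous/derivable1_diffP.
have F0 : g x = F 0 by rewrite /F scale0r add0r.
have [t0|t0] := leP 0 t.
  have [s + sE] := MVT_segment t0 (fun s _ => dF s) (continuous_subspaceT cF).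
  rewrite in_itv/= => /andP[s0 st]; exists s.
    by rewrite !ger0_norm.
  by rewrite F0 [LHS]sE subr0.
have [s + sE] := MVT_segment (ltW t0) (fun s _ => dF s) (continuous_subspaceT cF).
rewrite in_itv/= => /andP[ts s0]; exists s.
  by rewrite !ler0_norm ?(ltW t0)// lerN2.
by rewrite F0 -opprB [X in - X]sE sub0r mulrN opprK.
Qed.

End partial_derivatives.

(** * Polynomial functions: measurability, continuity, derivatives *)

Section peval_theory.
Context {R : realType} {n : nat}.
Implicit Types (f : mpoly.mpoly n R).

(** A monomial is a product of powers of variables, so sums and products reach every polynomial from
    constants and variables. *)
Lemma mpoly_ring_ind (Q : mpoly.mpoly n R -> Prop) :
  (forall c, Q (mpoly.mpolyC n c)) -> (forall i, Q (mpoly.mpolyX R (mpoly.mnm1 i))) ->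
  (forall p q, Q p -> Q q -> Q (p + q)) -> (forall p q, Q p -> Q q -> Q (p * q)) ->
  forall p, Q p.
Proof.
move=> QC QX QD QM p; elim/mpoly.mpolyind: p; first by rewrite -(mpoly.mpolyC0 n R).
move=> c m p _ _ Qp; apply: (QD _ _ _ Qp); rewrite -mpoly.mul_mpolyC; apply: (QM _ _ (QC c)).
have Q1 : Q 1 by rewrite -(mpoly.mpolyC1 n R).
rewrite mpoly.mpolyXE_id; apply: (big_ind Q Q1 QM) => i _.
elim: (mpoly.fun_of_multinom m i) => [|k IH]; first by rewrite expr0.
by rewrite exprS; exact: (QM _ _ (QX i) IH).
Qed.

Lemma pevalD f1 f2 : peval (f1 + f2) = peval f1 \+ peval f2.
Proof. by apply/funext => x; rewrite /peval mpoly.mevalD. Qed.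

Lemma pevalM f1 f2 : peval (f1 * f2) = peval f1 \* peval f2.
Proof. by apply/funext => x; rewrite /peval mpoly.mevalM. Qed.

Lemma pevalC c : peval (mpoly.mpolyC n c) = cst c :> ('rV[R]_n -> R).
Proof. by apply/funext => x; rewrite /peval mpoly.mevalC. Qed.

Lemma pevalX i : peval (mpoly.mpolyX R (mpoly.mnm1 i)) = (fun x : 'rV[R]_n => x ord0 i).
Proof. by apply/funext => x; rewrite /peval mpoly.mevalXU. Qed.

Lemma measurable_peval f : measurable_fun setT (peval f).
Proof.
elim/mpoly_ring_ind: f => [c|i|p q mp mq|p q mp mq].
- by rewrite pevalC; exact: measurable_cst.
- by rewrite pevalX; exact: measurable_coord.
- by rewrite pevalD; exact: measurable_funD.
- by rewrite pevalM; exact: measurable_funM.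
Qed.

Lemma continuous_peval f : continuous (peval f).
Proof.
elim/mpoly_ring_ind: f => [c|i|p q mp mq|p q mp mq].
- by rewrite pevalC; exact: cst_continuous.
- by rewrite pevalX; exact: coord_continuous.
- by rewrite pevalD => x; apply: continuousD; [exact: mp|exact: mq].
- by rewrite pevalM => x; apply: continuousM; [exact: mp|exact: mq].
Qed.

Lemma is_derive_coord (i : 'I_n) (x v : 'rV[R]_n) :
  is_derive x v ((fun y : 'rV[R]_n => y ord0 i) : 'rV[R]_n -> R^o) (v ord0 i).
Proof.
have : (fun h : R => h^-1 *: ((((fun y : 'rV[R]_n => y ord0 i) : 'rV[R]_n -> R^o)
    \o shift x) (h *: v) - x ord0 i)) @ 0^' --> (v ord0 i : R^o).
  apply: (@cvg_trans _ (cst (v ord0 i : R^o) @ (0 : R)^')); last exact: cvg_cst.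
  apply: near_eq_cvg; near=> h.
  rewrite /= !mxE addrK; have h0 : h != 0 by near: h; exact: nbhs_dnbhs_neq.
  by rewrite /cst/= /GRing.scale/= mulKf.
by move=> c; apply: DeriveDef; [apply/cvg_ex; exists (v ord0 i)|exact/cvg_lim].
Unshelve. all: by end_near. Qed.

(** The formal and the analytic derivative obey the same rules on constants, variables, sums and
    products. *)
Lemma has_partials_peval f :
  has_partials (peval f) (fun i => peval (mpoly.mderiv i f)).
Proof.
move=> i x; elim/mpoly_ring_ind: f => [c|j|p q dp dq|p q dp dq].
- by rewrite pevalC mpoly.mderivC -(mpoly.mpolyC0 n R) pevalC; exact: is_derive_cst.
- rewrite pevalX.
  have -> : peval (mpoly.mderiv i (mpoly.mpolyX R (mpoly.mnm1 j))) x
      = (delta_mx ord0 i : 'rV[R]_n) ord0 j.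
    rewrite mpoly.mderivX mpoly.mnm1E mxE eqxx/= eq_sym /peval mpoly.mevalZ.
    case: eqP => [->|_]; last by rewrite mul0r.
    by rewrite mpoly.mevalX big1 ?mulr1// => k _; rewrite mpoly.mnmBE subnn expr0.
  exact: is_derive_coord.
- by rewrite mpoly.mderivD !pevalD; exact: is_deriveD.
- rewrite mpoly.mderivM !pevalD !pevalM.
  apply: (is_derive_eq (is_deriveM dp dq)).
  by rewrite /GRing.scale/= addrC mulrC (mulrC (peval p x)).
Qed.

End peval_theory.

(** * Translations, packing and covering *)

Section lebesgue_rV_translation.
Context {R : realType} {n : nat}.
Local Notation vol := (lebesgue_rV n : {measure set 'rV[R]_n -> \bar R}).

Lemma sume_const_ord N (x : \bar R) : (\sum_(k < N) x = N%:R%:E * x)%E.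
Proof.
elim: N => [|N IH]; first by rewrite big_ord0 mul0e.
by rewrite big_ord_recr/= IH -natr1 EFinD ge0_muleDl ?lee_fin// mul1e.
Qed.

Lemma translate_diag_affine (v : 'rV[R]_n) :
  +%R v = diag_affine (fun=> 1) (fun i => v ord0 i).
Proof. by apply/funext => x; apply/rowP => i; rewrite !mxE mul1r addrC. Qed.

Lemma measurable_translate (v : 'rV[R]_n) (S : set 'rV[R]_n) :
  measurable S -> measurable (+%R v @^-1` S).
Proof.
move=> mS; rewrite translate_diag_affine -[X in measurable X]setTI.
exact: measurable_diag_affine.
Qed.

Lemma lebesgue_rV_translate (v : 'rV[R]_n) (S : set 'rV[R]_n) :
  measurable S -> vol (+%R v @^-1` S) = vol S.
Proof.
move=> mS; rewrite translate_diag_affine lebesgue_rV_diag_affine//.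
by rewrite big1// invr1 mul1e.
Qed.

Lemma lebesgue_rV_packing (v : nat -> 'rV[R]_n) (S Q : set 'rV[R]_n) N :
  measurable S -> measurable Q ->
  (forall k, (k < N)%N -> +%R (v k) @^-1` S `<=` Q) ->
  (forall k l x, (k < l)%N -> S (v k + x) -> S (v l + x) -> False) ->
  (N%:R%:E * vol S <= vol Q)%E.
Proof.
move=> mS mQ SQ Sdis.
(* The preimage under adding [v k] is the translate of [S] by [- v k]. *)
pose F k := +%R (v k) @^-1` S.
have mF k : measurable (F k) by exact: measurable_translate.
have tF : trivIset setT F.
  apply/trivIsetP => i j _ _ ij; apply/seteqP; split => // x [].
  rewrite /F/=; case: (ltngtP i j) ij => // ij _ Si Sj.
    exact: (Sdis i j x).
  exact: (Sdis j i x).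
have -> : (N%:R%:E * vol S = vol (\big[setU/set0]_(k < N) F k))%E.
  rewrite measure_bigsetU//.
  rewrite (eq_bigr (fun=> vol S)) => [|k _]; last exact: lebesgue_rV_translate.
  by rewrite sume_const_ord.
apply: le_measure; rewrite ?inE//; first exact: bigsetU_measurable.
by rewrite -bigcup_mkord => x [k /= kN]; exact: SQ.
Qed.

Lemma lebesgue_rV_covering (v : nat -> 'rV[R]_n) (S Q : set 'rV[R]_n) N :
  measurable S -> measurable Q ->
  (forall x, Q x -> exists2 k, (k < N)%N & S (v k + x)) ->
  (vol Q <= N%:R%:E * vol S)%E.
Proof.
move=> mS mQ QS; pose F k := +%R (v k) @^-1` S.
have -> : (N%:R%:E * vol S = \sum_(k < N) vol (F k))%E.
  rewrite (eq_bigr (fun=> vol S)) => [|k _]; last exact: lebesgue_rV_translate.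
  by rewrite sume_const_ord.
apply: content_subadditive => //; first by move=> k _; exact: measurable_translate.
by rewrite -bigcup_mkord => x /QS[k kN Sx]; exists k.
Qed.

Lemma ball_rVE (x : 'rV[R]_n) r : 0 < r ->
  ball x r = box (fun i => (ball (x ord0 i) r : set (measurableTypeR R))).
Proof.
move=> r0; apply/seteqP; split => y; rewrite /ball/= /mx_ball/box/=.
  by move=> [_ xy] i; exact: xy.
by move=> xy; split => // i j; rewrite (ord1 i); exact: xy.
Qed.

Lemma measurable_ball_rV (x : 'rV[R]_n) r : 0 < r -> measurable (ball x r).
Proof.
by move=> r0; rewrite ball_rVE//; apply: measurable_box => i; exact: measurable_ball.
Qed.

Lemma lebesgue_rV_ball_lty (x : 'rV[R]_n) r : 0 < r -> (vol (ball x r) < +oo)%E.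
Proof.
move=> r0; rewrite ball_rVE//; apply: lebesgue_rV_box_lty => i.
  exact: measurable_ball.
by rewrite lebesgue_measure_ball ?ltW// ltry.
Qed.

Lemma lebesgue_rV_ball_gt0 (x : 'rV[R]_n) r : 0 < r -> (0 < vol (ball x r))%E.
Proof.
move=> r0; rewrite ball_rVE// lebesgue_rV_boxE => [|i]; last exact: measurable_ball.
under eq_bigr do rewrite lebesgue_measure_ball ?ltW//.
by rewrite prodEFin lte_fin prodr_gt0// => i _; rewrite pmulrn_rgt0.
Qed.

End lebesgue_rV_translation.

(** * Volume of sublevel sets near a point with a nonzero partial derivative *)

Section sublevel_sets.
Context {R : realType} {n : nat}.
Local Notation vol := (lebesgue_rV n : {measure set 'rV[R]_n -> \bar R}).
Local Notation e i := (delta_mx ord0 i : 'rV[R]_n).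
Variables (g : 'rV[R]_n -> R) (dg : 'I_n -> 'rV[R]_n -> R).
Hypothesis gdg : has_partials g dg.
Hypothesis cg : continuous g.
Hypothesis cdg : forall i, continuous (dg i).
Hypothesis mg : measurable_fun setT g.

Lemma measurable_norm_lt r : measurable [set x | `|g x| < r].
Proof.
rewrite -[X in measurable X]setTI; apply: (measurable_fun_ltr (g := cst r)) => //.
exact: measurableT_comp.
Qed.

Lemma measurable_norm_gt r : measurable [set x | r < `|g x|].
Proof.
rewrite -[X in measurable X]setTI; apply: (measurable_fun_ltr (f := cst r)) => //.
exact: measurableT_comp.
Qed.

Let norm_e_gt0 i : 0 < `|e i|.
Proof.
rewrite normr_gt0; apply/eqP => /rowP/(_ i)/eqP.
by rewrite !mxE !eqxx/= oner_eq0.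
Qed.

(* The translates of the sublevel set by multiples of (2 r / c) e_j, where c
   bounds |dg j| from below, are disjoint because g moves by at least 2 r
   between two of them. *)
Lemma sublevel_le x0 j : dg j x0 != 0 ->
  exists2 del, 0 < del & exists2 K : R, 0 <= K & forall r, 0 < r ->
    (vol (ball x0 del `&` [set x | (`|g x| < r)%R]) <= (K * r)%:E)%E.
Proof.
move=> dg0; pose c := `|dg j x0| / 2.
have c0 : 0 < c by rewrite divr_gt0// normr_gt0.
have /nbhs_ballP[eps /= eps0 dgc] : nbhs x0 [set y | c < `|dg j y|].
  have : (fun y => `|dg j y|) @ x0 --> `|dg j x0|.
    by apply: continuous_comp; [exact: cdg|exact: norm_continuous].
  by move=> /cvgr_gt; apply; rewrite /c; have := dg0; rewrite -normr_gt0; lra.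
pose E := `|e j|; have E0 : 0 < E := norm_e_gt0 j.
(* Two points of the ball of radius [del] differ by less than 2 [del], so a mean value point between
   them is within 3 [del] = [eps] of x0, where the bound [c] holds. *)
pose del := eps / 3; have del0 : 0 < del by rewrite divr_gt0.
have Qoo := lebesgue_rV_ball_lty x0 eps0.
pose b := fine (vol (ball x0 eps)).
have bE : vol (ball x0 eps) = b%:E by rewrite fineK// ge0_fin_numE.
have b0 : 0 <= b by rewrite fine_ge0.
(* From N + 1 > [del] / ([tau] E) and [tau] = 2 r / c it follows that vol S <= [b] [tau] E / [del] =
   [K] r. *)
pose K := b * (2 * E / (c * del)).
exists del => //; exists K => [|r r0].
  by apply: mulr_ge0 => //; apply: divr_ge0; apply: mulr_ge0; rewrite ?ltW.
pose tau := 2 * r / c; have tau0 : 0 < tau by rewrite divr_gt0// mulr_gt0.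
(* The largest number of steps whose total displacement has norm at most [del]. *)
pose N := Num.truncn (del / (tau * E)).
set S := _ `&` _.
have mS : measurable S.
  by apply: measurableI; [exact: measurable_ball_rV|exact: measurable_norm_lt].
have ms' : (N.+1%:R%:E * vol S <= vol (ball x0 eps))%E.
  apply: (@lebesgue_rV_packing _ _ (fun k => - (k%:R * tau) *: e j)) => //.
  - exact: measurable_ball_rV.
  - move=> k kN x [+ _]; rewrite -!ball_normE/= => xdel.
    have kdel : `|(k%:R * tau) *: e j| <= del.
      have k_le : k%:R <= del / (tau * E).
        apply: (@le_trans _ _ N%:R); first by rewrite ler_nat.
        by rewrite truncn_le; apply/ltW/divr_gt0 => //; exact: mulr_gt0.
      rewrite normrZ ger0_norm; last by rewrite mulr_ge0// ltW.
      by rewrite -mulrA -ler_pdivlMr// mulr_gt0.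
    rewrite scaleNr in xdel.
    rewrite (_ : x0 - x = (x0 - (- ((k%:R * tau) *: e j) + x)) - (k%:R * tau) *: e j); last first.
      by rewrite opprD opprK addrA addrAC addrK.
    rewrite (le_lt_trans (ler_normB _ _))//.
    rewrite (lt_le_trans (ltr_leD xdel kdel))// /del; lra.
  - move=> k l x kl [+ gk] [+ gl]; rewrite -!ball_normE/= in gk gl *.
    set y := _ + x in gk *; set z := _ + x in gl * => yd zd.
    pose t := (l%:R - k%:R) * tau.
    have yE : y = t *: e j + z.
      by rewrite /y /z addrA -scalerDl /t; congr (_ *: _ + _); ring.
    have [s st gE] := has_partials_MVT j z t gdg.
    rewrite -yE in gE.
    have tt : tau <= t.
      rewrite /t -natrB ?(ltnW kl)//; apply: ler_peMl; first exact: ltW.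
      by rewrite ler1n subn_gt0.
    have tdel : `|t *: e j| < 2 * del.
      rewrite (_ : t *: e j = (x0 - z) - (x0 - y)); last first.
        by rewrite opprB addrC subrKA yE addrK.
      by rewrite (le_lt_trans (ler_normB _ _))// mulr_natl mulr2n ltrD.
    have : c < `|dg j (s *: e j + z)|.
      apply: dgc; rewrite -ball_normE/=.
      rewrite opprD addrCA (le_lt_trans (ler_normD _ _))// normrN.
      rewrite normrZ; move: tdel; rewrite normrZ => tdel.
      have := ler_wpM2r (ltW E0) st; rewrite /E => sE.
      rewrite (@lt_le_trans _ _ (2 * del + del))//; last by rewrite /del; lra.
      by rewrite ltr_leD// ?(le_lt_trans sE)// ltW.
    have : `|g y - g z| < 2 * r.
      by rewrite (le_lt_trans (ler_normB _ _))// mulr_natl mulr2n ltrD.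
    rewrite gE normrM => lt1 lt2.
    have : c * tau <= `|dg j (s *: e j + z)| * `|t|.
      by apply: ler_pM; [exact: ltW|exact: ltW|exact: ltW|exact: le_trans tt (ler_norm _)].
    by rewrite leNgt (lt_le_trans lt1)// /tau mulrCA mulfV ?mulr1// gt_eqF.
have Soo : (vol S < +oo)%E.
  rewrite (le_lt_trans _ (lebesgue_rV_ball_lty x0 del0))//.
  by apply: le_measure; rewrite ?inE//; [exact: measurable_ball_rV|exact: subIsetl].
have fE : vol S = (fine (vol S))%:E by rewrite fineK// ge0_fin_numE.
rewrite [X in (X <= _)%E]fE lee_fin; move: ms'; rewrite fE bE -EFinM lee_fin.
have : del / (tau * E) < N.+1%:R by exact: truncnS_gt.
have : 0 <= fine (vol S) by exact: fine_ge0.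
move: (fine (vol S)) (N.+1%:R : R) => s m s0 mdel ms.
have sb : s * (del / (tau * E)) <= b.
  by rewrite (le_trans _ ms)// mulrC; apply: ler_wpM2r => //; exact: ltW.
have d0 : 0 < del / (tau * E) by apply: divr_gt0 => //; exact: mulr_gt0.
rewrite -ler_pdivlMr// in sb; apply: (le_trans sb).
by rewrite /K /tau le_eqVlt; apply/orP; left; apply/eqP; field; rewrite !gt_eqF.
Qed.

Lemma measurable_norm_itv r : measurable [set x | 0 < `|g x| < r].
Proof.
rewrite (_ : [set x | _] = [set x | 0 < `|g x|] `&` [set x | `|g x| < r]).
  by apply: measurableI; [exact: measurable_norm_gt|exact: measurable_norm_lt].
by apply/seteqP; split => x /=; [move=> /andP[]|move=> [-> ->]].
Qed.

(* Along e_j, g changes sign near x0, and in steps of length O(r) it cannot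
   jump over ]0, r[: O(1/r) translates of the set cover a fixed ball. *)
Lemma sublevel_ge x0 j V : g x0 = 0 -> dg j x0 != 0 -> nbhs x0 V ->
  measurable V ->
  exists2 c : R, 0 < c & exists2 r0 : R, 0 < r0 & forall r, 0 < r < r0 ->
    ((c * r)%:E <= vol (V `&` [set x | (0 < `|g x| < r)%R]))%E.
Proof.
move=> g0 dg0 V0 mV; pose D := dg j x0; pose M := `|D| + 1.
have M0 : 0 < M by rewrite ltr_wpDl.
have D2 : 0 < D * D by rewrite -expr2 exprn_even_gt0.
have : nbhs x0 ([set y | `|dg j y| < M] `&` [set y | 0 < D * dg j y] `&` V).
  apply: filterI => //; apply: filterI.
    have : (fun y => `|dg j y|) @ x0 --> `|D|.
      by apply: continuous_comp; [exact: cdg|exact: norm_continuous].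
    by move=> /cvgr_lt; apply; rewrite /M ltrDl.
  have : (fun y => D * dg j y) @ x0 --> D * D.
    by apply: (continuousM (s := cst D)); [exact: cst_continuous|exact: cdg].
  by move=> /cvgr_gt; exact.
move=> /nbhs_ballP[eps /= eps0 epsP].
pose E := `|e j|; have E0 : 0 < E := norm_e_gt0 j.
have nD0 : 0 < `|D| by rewrite normr_gt0.
(* With this [b], 3 |[a]| amounts to a displacement eps / 2 along e_j, which keeps points of the
   half ball inside the ball. The factor D in [a] makes g increase from - [a] to [a] whatever the
   sign of the derivative. *)
pose b := eps / (6 * E * `|D|).
have b0 : 0 < b by rewrite divr_gt0// !mulr_gt0.
pose a := b * D.
have aE : `|a| * E = eps / 6.
  by rewrite /a normrM gtr0_norm// /b; field; rewrite !gt_eqF.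
have na0 : 0 < `|a| by rewrite normr_gt0 mulf_neq0// gt_eqF.
have near_ball y s : ball x0 (eps / 2) y -> `|s| <= 3 * `|a| ->
    ball x0 eps (s *: e j + y).
  rewrite -!ball_normE/= => yx sa; rewrite opprD addrCA.
  rewrite (le_lt_trans (ler_normD _ _))// normrN normrZ.
  have := ler_wpM2r (ltW E0) sa; rewrite -mulrA aE -/E; move: (_ * E) yx => ? ?; lra.
have x0half : ball x0 (eps / 2) x0 by apply: ballxx; rewrite divr_gt0.
have gp : 0 < g (a *: e j + x0).
  have [s sa] := has_partials_MVT j x0 a gdg; rewrite g0 subr0 => ->.
  have /epsP[[_ /=]] := near_ball x0 s x0half (le_trans sa (ler_peMl (normr_ge0 a) (ler1n _ 3))).
  by rewrite /a mulrCA mulrC (mulrC (dg _ _)) => ? _; exact: mulr_gt0.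
have gn : g (- a *: e j + x0) < 0.
  have [s sa] := has_partials_MVT j x0 (- a) gdg; rewrite g0 subr0 => ->.
  rewrite normrN in sa.
  have /epsP[[_ /=]] := near_ball x0 s x0half (le_trans sa (ler_peMl (normr_ge0 a) (ler1n _ 3))).
  by rewrite mulrN oppr_lt0 /a mulrCA mulrC (mulrC (dg _ _)) => ? _; exact: mulr_gt0.
pose m := g (a *: e j + x0) / 2.
have m0 : 0 < m by rewrite divr_gt0.
have cgt t : (fun y => g (t *: e j + y)) @ x0 --> g (t *: e j + x0).
  apply: continuous_comp; last exact: cg.
  by apply: (@continuousD _ _ _ (cst (t *: e j)) id); [exact: cst_continuous|exact: cvg_id].
have : nbhs x0 ([set y | m < g (a *: e j + y)] `&` [set y | g (- a *: e j + y) < 0]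
     `&` ball x0 (eps / 2)).
  apply: filterI; last by apply: nbhsx_ballx; rewrite divr_gt0.
  apply: filterI; first by have /cvgr_gt := cgt a; apply; rewrite /m; lra.
  by have /cvgr_lt := cgt (- a); exact.
move=> /nbhs_ballP[eta /= eta0 etaP].
pose beta := fine (vol (ball x0 eta)).
have betaE : vol (ball x0 eta) = beta%:E.
  by rewrite fineK// ge0_fin_numE// lebesgue_rV_ball_lty.
have beta0 : 0 < beta by rewrite -lte_fin -betaE; exact: lebesgue_rV_ball_gt0.
(* N + 1 is at most 4 M |[a]| / r + 2, and 2 <= 2 m / r since r < m; hence N + 1 <= [L] / r. *)
pose L := 4 * M * `|a| + 2 * m.
have L0 : 0 < L by rewrite addr_gt0 ?mulr_gt0.
exists (beta / L); first exact: divr_gt0.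
exists m => // r /andP[r0 rm].
set S := V `&` _.
have mS : measurable S by apply: measurableI => //; exact: measurable_norm_itv.
(* One step of the grid from - [a] to [a] changes g by at most 2 M |[a]| / N, which is less than
   r. *)
pose N := (Num.truncn (4 * M * `|a| / r)).+1.
have N0 : 0 < N%:R :> R by rewrite ltr0n.
have NM : 4 * M * `|a| / r < N%:R by exact: truncnS_gt.
pose v (k : nat) := (2 * k%:R / N%:R - 1) * a.
have cov : (vol (ball x0 eta) <= N.+1%:R%:E * vol S)%E.
  apply: (@lebesgue_rV_covering _ _ (fun k => v k *: e j)) => //.
    exact: measurable_ball_rV.
  move=> y /etaP[[/= gpy gny] yhalf].
  have ex : exists k, 0 < g (v k *: e j + y).
    exists N; rewrite /v mulfK ?gt_eqF// (_ : 2 - 1 = 1); last by ring.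
    by rewrite mul1r (lt_trans _ gpy).
  (* At the first grid point where g is positive, the previous value is at most 0, so g there is
     below one increment. Index 0 is excluded because g is negative at - [a]. *)
  case: (ex_minnP ex) => [[|k]] gk kmin.
    by move: gk; rewrite /v mulr0 mul0r sub0r mulN1r ltNge (ltW gny).
  have kN : (k.+1 <= N)%N.
    apply: kmin; rewrite /v mulfK ?gt_eqF// (_ : 2 - 1 = 1); last by ring.
    by rewrite mul1r (lt_trans _ gpy).
  have gk' : g (v k *: e j + y) <= 0.
    by rewrite leNgt; apply/negP => /kmin; rewrite ltnn.
  have vle l : (l <= N)%N -> `|v l| <= `|a|.
    move=> lN; rewrite /v normrM ler_piMl// ler_norml.
    have : l%:R / N%:R <= 1 :> R by rewrite ler_pdivrMr// mul1r ler_nat.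
    have : 0 <= l%:R / N%:R :> R by rewrite divr_ge0.
    by rewrite -mulrA; move: (_ / _) => u; lra.
  exists k.+1 => //; split.
    have [] // := epsP (v k.+1 *: e j + y); apply: near_ball => //.
    by rewrite (le_trans (vle _ _))// ler_peMl// ler1n.
  rewrite /= ger0_norm ?(ltW gk)// gk/=.
  pose t := 2 / N%:R * a.
  have vS : v k.+1 *: e j + y = t *: e j + (v k *: e j + y).
    rewrite addrA -scalerDl; congr (_ *: _ + _).
    by rewrite /v /t -natr1; field; rewrite gt_eqF.
  have [s st] := has_partials_MVT j (v k *: e j + y) t gdg.
  rewrite -vS => gE.
  have ta : `|t| <= 2 * `|a|.
    rewrite /t normrM ler_wpM2r// ger0_norm ?divr_ge0// ler_pdivrMr//.
    by rewrite ler_peMr// ler1n.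
  have : `|dg j (s *: e j + (v k *: e j + y))| < M.
    have /epsP[[]//] : ball x0 eps (s *: e j + (v k *: e j + y)).
    rewrite addrA -scalerDl; apply: near_ball => //.
    rewrite (le_trans (ler_normD _ _))//.
    by have := vle k (ltnW kN); lra.
  move=> dM.
  have : g (v k.+1 *: e j + y) <= M * `|t|.
    rewrite (@le_trans _ _ (g (v k.+1 *: e j + y) - g (v k *: e j + y)))//.
      by rewrite lerDl oppr_ge0.
    by rewrite gE (le_trans (ler_norm _))// normrM ler_wpM2r// ltW.
  move=> gM; apply: (le_lt_trans gM).
  rewrite /t normrM ger0_norm ?divr_ge0//.
  move: NM; rewrite ltr_pdivrMr// => NM.
  rewrite (_ : M * _ = (2 * M * `|a|) / N%:R); last by ring.
  rewrite ltr_pdivrMr//.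
  have : 0 < M * `|a| by rewrite mulr_gt0.
  by rewrite (mulrC r); move: NM; lra.
have [Soo|] := ltP (vol S) +oo%E; last by rewrite leye_eq => /eqP ->; rewrite leey.
have fE : vol S = (fine (vol S))%:E by rewrite fineK// ge0_fin_numE.
have s0 : 0 <= fine (vol S) by exact: fine_ge0.
rewrite [X in (_ <= X)%E]fE lee_fin; move: cov; rewrite fE betaE -EFinM lee_fin.
move: (fine (vol S)) s0 => s s0 cov.
have NL : N.+1%:R <= L / r.
  rewrite /N -addn2 (natrD _ (Num.truncn _)) /L (mulrDl (4 * M * _)).
  have : (Num.truncn (4 * M * `|a| / r))%:R <= 4 * M * `|a| / r.
    by rewrite truncn_le; apply: divr_ge0; rewrite ?mulr_ge0 ?ltW.
  have : 2 <= 2 * m / r by rewrite ler_pdivlMr// ler_pM2l// ltW.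
  lra.
have : beta <= L / r * s by rewrite (le_trans cov)// ler_wpM2r.
by rewrite -ler_pdivrMl ?divr_gt0// => /(le_trans _); apply; rewrite le_eqVlt;
  apply/orP; left; apply/eqP; field; rewrite !gt_eqF.
Qed.

End sublevel_sets.

(** * Integrals of functions bounded by constants *)

Section integral_const_bounds.
Context d (T : measurableType d) (R : realType) (mu : {measure set T -> \bar R}).
Variables (h : T -> \bar R) (A : set T).
Hypothesis mA : measurable A.
Hypothesis mh : measurable_fun setT h.
Hypothesis h0 : (forall x, 0 <= h x)%E.
Local Open Scope ereal_scope.

Lemma ge0_integral_le_cst (M : R) : (forall x, A x -> h x <= M%:E) ->
  \int[mu]_(x in A) h x <= M%:E * mu A.
Proof.
move=> hM; have mhA : measurable_fun A h by exact: measurable_funTS.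
have [->|/set0P[x0 Ax0]] := eqVneq A set0; first by rewrite integral_set0 measure0 mule0.
have M0 : 0 <= M%:E by rewrite (le_trans (h0 x0))// hM.
by rewrite -integral_cst//; apply: ge0_le_integral.
Qed.

Lemma ge0_integral_ge_cst (m : R) : (0 <= m)%R -> (forall x, A x -> m%:E <= h x) ->
  m%:E * mu A <= \int[mu]_(x in A) h x.
Proof.
move=> m0 hm; have mhA : measurable_fun A h by exact: measurable_funTS.
by rewrite -integral_cst//; apply: ge0_le_integral => // x _; rewrite lee_fin.
Qed.

Lemma ge0_integral_eq0_measure0 : \int[mu]_(x in A) h x = 0 ->
  (forall x, A x -> 0 < h x) -> mu A = 0.
Proof.
move=> hA hp; have mhA : measurable_fun A h by exact: measurable_funTS.
have : \int[mu]_(x in A) `|h x| = 0.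
  by rewrite -hA; apply: eq_integral => x _; rewrite gee0_abs.
move/ae_eq_integral_abs => /(_ mA mhA) [N [mN N0 AN]].
apply/eqP; rewrite eq_le measure_ge0 andbT -N0.
apply: le_measure; rewrite ?inE// => x Ax; apply: AN => /(_ Ax) hx0.
by have := hp x Ax; rewrite hx0 ltxx.
Qed.

End integral_const_bounds.

(** * Uniform sublevel bounds on compact sets *)

Section compact_sublevel.
Context {R : realType} {n : nat}.
Local Notation vol := (lebesgue_rV n : {measure set 'rV[R]_n -> \bar R}).
Variables (g : 'rV[R]_n -> R) (dg : 'I_n -> 'rV[R]_n -> R).
Hypothesis gdg : has_partials g dg.
Hypothesis cg : continuous g.
Hypothesis cdg : forall i, continuous (dg i).
Hypothesis mg : measurable_fun setT g.

Lemma sublevel_le_neq0 x0 : g x0 != 0 ->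
  exists2 del, 0 < del & exists2 K : R, 0 <= K & forall r, 0 < r ->
    (vol (ball x0 del `&` [set x | (`|g x| < r)%R]) <= (K * r)%:E)%E.
Proof.
move=> g0; pose m := `|g x0| / 2.
have m0 : 0 < m by rewrite divr_gt0// normr_gt0.
have /nbhs_ballP[eps /= eps0 gm] : nbhs x0 [set y | m < `|g y|].
  have : (fun y => `|g y|) @ x0 --> `|g x0|.
    by apply: continuous_comp; [exact: cg|exact: norm_continuous].
  by move=> /cvgr_gt; apply; rewrite /m; have := g0; rewrite -normr_gt0; lra.
have Qoo := lebesgue_rV_ball_lty x0 eps0.
pose b := fine (vol (ball x0 eps)).
have bE : vol (ball x0 eps) = b%:E by rewrite fineK// ge0_fin_numE.
have b0 : 0 <= b by rewrite fine_ge0.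
have bm0 : 0 <= b / m by rewrite divr_ge0// ltW.
exists eps => //; exists (b / m) => [//|r r0].
have [rm|mr] := leP r m.
  rewrite (_ : _ `&` _ = set0); first by rewrite measure0 lee_fin mulr_ge0// ltW.
  apply/seteqP; split => // y [/gm/= my yr].
  by have := lt_trans (le_lt_trans rm my) yr; rewrite ltxx.
apply: (@le_trans _ _ b%:E).
  rewrite -bE; apply: le_measure; rewrite ?inE//.
    by apply: measurableI; [exact: measurable_ball_rV|exact: measurable_norm_lt].
  exact: measurable_ball_rV.
by rewrite lee_fin mulrAC ler_pdivlMr// ler_wpM2l// ltW.
Qed.

(** Finitely many balls with a local bound cover [C], and their constants add up; a subset [A] is
    cut along the balls, one at a time. *)
Lemma compact_sublevel_le (C : set 'rV[R]_n) : compact C ->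
  (forall x, C x -> g x != 0 \/ exists j, dg j x != 0) ->
  exists2 K : R, 0 <= K & forall r A, 0 < r -> measurable A -> A `<=` C ->
    (vol (A `&` [set x | (`|g x| < r)%R]) <= (K * r)%:E)%E.
Proof.
move=> cC Cg.
(* Stated at every point so that [choice] applies; outside [C] the radius 0 is a dummy. *)
have loc x : exists del : R, C x -> 0 < del /\ exists2 K : R, 0 <= K & forall r, 0 < r ->
    (vol (ball x del `&` [set x | (`|g x| < r)%R]) <= (K * r)%:E)%E.
  have [Cx|nCx] := pselect (C x); last by exists 0.
  have [g0|[j dg0]] := Cg x Cx.
    by have [del d0 P] := sublevel_le_neq0 g0; exists del.
  by have [del d0 P] := sublevel_le gdg cdg mg dg0; exists del.
have [del delP] := choice loc.
move: cC; rewrite compact_cover => /(_ _ C (fun x => ball x (del x))).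
case => [x _|x Cx|D DC CD].
- exact: ball_open.
- by exists x => //; apply: ballxx; have [] := delP x Cx.
have [s sC Cs] : exists2 s : seq 'rV[R]_n, (forall x, x \in s -> C x) &
    C `<=` [set y | exists2 x, x \in s & ball x (del x) y].
  exists (finmap.enum_fset D) => [x xD|y /CD[x xD xy]]; last by exists x.
  by apply/set_mem/DC.
have [K K0 KP] : exists2 K : R, 0 <= K & forall r A, 0 < r -> measurable A ->
    A `<=` [set y | exists2 x, x \in s & ball x (del x) y] ->
    (vol (A `&` [set x | (`|g x| < r)%R]) <= (K * r)%:E)%E.
  elim: s sC {Cs} => [_|x s IH sC].
    exists 0 => // r A r0 mA A0; rewrite (_ : _ `&` _ = set0) ?measure0 ?mul0r//.
    by apply/seteqP; split => // y [/A0[]].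
  have [K K0 KP] := IH (fun y ys => sC y (mem_behead (s := x :: s) ys)).
  have [dx0 [K' K'0 K'P]] := delP x (sC x (mem_head _ _)).
  exists (K' + K) => [|r A r0 mA As]; first exact: addr_ge0.
  have mB := measurable_ball_rV x dx0.
  have mL := measurable_norm_lt mg r.
  rewrite -(setUIDK A (ball x (del x))) setIUl.
  apply: le_trans.
    by apply: measureU2; apply: measurableI => //;
      [exact: measurableI|exact: measurableD].
  rewrite mulrDl EFinD; apply: leeD.
    apply: le_trans (K'P r r0); apply: le_measure; rewrite ?inE//.
    - by apply: measurableI => //; exact: measurableI.
    - exact: measurableI.
    - by apply: setSI; exact: subIsetr.
  apply: KP => //; first exact: measurableD.
  move=> y [/As[z]]; rewrite inE => /predU1P[->//|zs zy _].
  by exists z.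
by exists K => // r A r0 mA AC; apply: KP => // y /AC/Cs.
Qed.

End compact_sublevel.

(** * Integrability of |g|^(-s) for s < 1 *)

Lemma exists_half_expr_lt (R : realType) (eps : R) : 0 < eps ->
  exists k, 2^-1 ^+ k < eps.
Proof.
move=> eps0; exists (Num.truncn eps^-1).+1.
rewrite exprVn invf_plt ?posrE ?exprn_gt0//.
by rewrite (lt_le_trans (truncnS_gt _))// -natrX ler_nat ltnW// ltn_expl.
Qed.

Section integral_negative_power.
Context {R : realType} {n : nat}.
Local Notation vol := (lebesgue_rV n : {measure set 'rV[R]_n -> \bar R}).
Variables (g : 'rV[R]_n -> R).
Hypothesis mg : measurable_fun setT g.

Lemma powRX (x b : R) m : 0 <= x -> (x ^+ m) `^ b = (x `^ b) ^+ m.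
Proof.
by move=> x0; rewrite -powR_mulrn// powRAC powR_mulrn// powR_ge0.
Qed.

Lemma le_powR_neg (x y s : R) : 0 <= s -> 0 < x -> x <= y -> y `^ (- s) <= x `^ (- s).
Proof.
move=> s0 x0 xy; have y0 := lt_le_trans x0 xy.
rewrite !powRN lef_pV2 ?posrE ?powR_gt0//.
by apply: ge0_ler_powR => //; rewrite nnegrE ltW.
Qed.

Lemma measurable_norm_powR b : measurable_fun setT (fun x => (`|g x| `^ b)%:E).
Proof.
apply/measurable_EFinP; apply: (measurableT_comp (measurable_powR b)).
exact: measurableT_comp.
Qed.

(** On the layer 2^-(k+1) <= |g| < 2^-k the integrand is at most 2^(s(k+1)) and the volume at most K
    2^-k: the ratio of the series is 2^(s-1) < 1. *)
Lemma integral_norm_powR_lty (C : set 'rV[R]_n) (K s : R) :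
  measurable C -> (vol C < +oo)%E -> 0 <= K ->
  (forall r : R, 0 < r ->
     (vol (C `&` [set x | (`|g x| < r)%R]) <= (K * r)%:E)%E) ->
  0 < s < 1 ->
  (\int[lebesgue_rV n]_(x in C) (`|g x| `^ (- s))%:E < +oo)%E.
Proof.
move=> mC Coo K0 KP /andP[s0 s1].
pose q : R := 2^-1; have q0 : 0 < q by rewrite invr_gt0.
pose F k := C `&` ~` [set x | `|g x| < q ^+ k].
have mF k : measurable (F k).
  by apply: measurableI => //; apply: measurableC; exact: measurable_norm_lt.
have ndF : nondecreasing_seq F.
  apply/nondecreasing_seqP => k; apply/subsetPset => x [Cx gx]; split => // xk.
  apply: gx; apply: (lt_le_trans xk); rewrite exprS ler_piMl ?exprn_ge0 ?ltW//.
  by rewrite invf_lt1// ltr1n.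
have mh := measurable_norm_powR (- s).
have h0 x : (0 <= (`|g x| `^ (- s))%:E)%E by rewrite lee_fin powR_ge0.
have UF : (\int[lebesgue_rV n]_(x in \bigcup_k F k) (`|g x| `^ (- s))%:E < +oo)%E.
  apply: (@ge0_integral_geometric_lty _ _ _ _ _ mh h0 F (K * q `^ (- s)) (q `^ (- s) * q)) => //.
  - apply: (@le_lt_trans _ _ (1%:E * vol (F 0%N))%E).
      apply: ge0_integral_le_cst => // x [_ /negP]; rewrite -leNgt expr0 => g1.
      by rewrite lee_fin (le_trans (le_powR_neg (ltW s0) ltr01 g1))// powR1.
    rewrite mul1e (le_lt_trans _ Coo)//; apply: le_measure; rewrite ?inE//.
    exact: subIsetl.
  - rewrite mulr_ge0 ?powR_ge0 ?ltW//=.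
    have -> : q `^ (- s) * q = q `^ (1 - s).
      rewrite powRD; last by rewrite (gt_eqF q0) implybT.
      by rewrite powRr1 ?(ltW q0)// mulrC.
    suff : q `^ (1 - s) < 1 `^ (1 - s) by rewrite powR1.
    apply: gt0_ltr_powR; rewrite ?subr_gt0//.
    - by rewrite nnegrE ltW.
    - by rewrite nnegrE.
    - by rewrite invf_lt1// ltr1n.
  - move=> k.
    have mFk : measurable (F k.+1 `\` F k) by exact: measurableD.
    apply: (@le_trans _ _ (((q `^ (- s)) ^+ k.+1)%:E * vol (F k.+1 `\` F k))%E).
      apply: ge0_integral_le_cst => // x [[_ /negP]]; rewrite -leNgt => gk _.
      rewrite lee_fin -(powRX _ _ (ltW q0)); apply: le_powR_neg => //; first exact: ltW.
      exact: exprn_gt0.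
    apply: (@le_trans _ _ (((q `^ (- s)) ^+ k.+1)%:E * (K * q ^+ k)%:E)%E).
      rewrite lee_wpmul2l// ?lee_fin ?exprn_ge0 ?powR_ge0//.
      apply: le_trans (KP _ (exprn_gt0 k q0)); apply: le_measure; rewrite ?inE//.
        by apply: measurableI => //; exact: measurable_norm_lt.
      move=> x [[Cx _] nF]; split => //=.
      by apply: contrapT => xk; apply: nF; split.
    rewrite -EFinM lee_fin le_eqVlt; apply/orP; left; apply/eqP.
    by rewrite exprMn exprS; ring.
rewrite (@ge0_integral_setD _ _ _ _ _ mh h0 (\bigcup_k F k) C)//; last 2 first.
  exact: bigcupT_measurable.
  by move=> x [k _ []].
rewrite [X in (_ + X)%E](_ : _ = 0%E) ?adde0//.
(* Outside the union of the [F k] g vanishes, and there the power is 0 by the convention on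
   [powR]. *)
apply: integral0_eq => x [Cx nF]; suff -> : g x = 0.
  by rewrite normr0 powR0// oppr_eq0 gt_eqF.
apply/eqP/negPn/negP => gx0; apply: nF.
have gx0' : 0 < `|g x| by rewrite normr_gt0.
have [k qk] := exists_half_expr_lt gx0'.
exists k => //; split => //=; apply/negP; rewrite -leNgt; exact: ltW.
Qed.

End integral_negative_power.

(** * Weighted dilations and boxes *)

Section dilations.
Context {R : realType} {n : nat}.
Local Notation vol := (lebesgue_rV n : {measure set 'rV[R]_n -> \bar R}).
Variable w : 'I_n -> nat.
Hypothesis w0 : forall i, (0 < w i)%N.

Definition dil (eps : R) (x : 'rV[R]_n) : 'rV[R]_n :=
  \row_i (eps ^+ w i * x ord0 i).

(** Half-side r^w_i in direction i, so that [dil eps] carries the box of parameter r onto that of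
    parameter [eps * r]. *)
Definition wbox (r : R) : set 'rV[R]_n :=
  box (fun i => (ball (0 : R) (r ^+ w i) : set (measurableTypeR R))).

Lemma wboxP r x : wbox r x <-> forall i, `|x ord0 i| < r ^+ w i.
Proof.
by split => xr i; have := xr i; rewrite -ball_normE/= sub0r normrN.
Qed.

Lemma measurable_wbox r : measurable (wbox r).
Proof. by apply: measurable_box => i; exact: measurable_ball. Qed.

Lemma lebesgue_rV_wbox_lty r : 0 < r -> (vol (wbox r) < +oo)%E.
Proof.
move=> r0; apply: lebesgue_rV_box_lty => i; first exact: measurable_ball.
by rewrite lebesgue_measure_ball ?exprn_ge0 ?ltW// ltry.
Qed.

Lemma subset_wbox r s : 0 <= r -> r <= s -> wbox r `<=` wbox s.
Proof.
move=> r0 rs x /wboxP xr; apply/wboxP => i; apply: (lt_le_trans (xr i)).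
by apply: lerXn2r => //; rewrite nnegrE// (le_trans r0).
Qed.

Lemma preimage_dil_wbox eps r : 0 < eps -> dil eps @^-1` wbox (eps * r) = wbox r.
Proof.
move=> e0; apply/seteqP; split => x /wboxP xr; apply/wboxP => i.
  have := xr i; rewrite mxE normrM exprMn ger0_norm ?exprn_ge0 ?ltW//.
  by rewrite ltr_pM2l ?exprn_gt0.
rewrite mxE normrM exprMn ger0_norm ?exprn_ge0 ?ltW//.
by rewrite ltr_pM2l ?exprn_gt0.
Qed.

Lemma wbox1_nbhs : nbhs (0 : 'rV[R]_n) (wbox 1).
Proof.
apply/nbhs_ballP; exists 1 => //= x; rewrite ball_rVE// => xb i.
by have := xb i; rewrite mxE expr1n.
Qed.

(** For r <= 1 and weights at least 1, r^w_i <= r puts the weighted box inside an ordinary ball. *)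
Lemma nbhs0_wbox U : nbhs (0 : 'rV[R]_n) U ->
  exists2 r : R, 0 < r <= 1 & wbox r `<=` U.
Proof.
move=> /nbhs_ballP[e /= e0 eU]; exists (Num.min e 1).
  by rewrite lt_min e0 ltr01 ge_min lexx orbT.
move=> x /wboxP xe; apply: eU; rewrite ball_rVE// => i.
rewrite -ball_normE/= mxE sub0r normrN (lt_le_trans (xe i))//.
have m0 : 0 <= Num.min e 1 by rewrite le_min (ltW e0) ler01.
have m1 : Num.min e 1 <= 1 by rewrite ge_min lexx orbT.
rewrite (le_trans _ (_ : Num.min e 1 <= e)) ?ge_min ?lexx//.
by rewrite -[leRHS]expr1; apply: ler_wiXn2l.
Qed.

Lemma wbox_nbhs r x : wbox r x -> nbhs x (wbox r).
Proof.
move=> /wboxP xr.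
have near_r (j : 'I_n) : \forall y \near x, `|(y : 'rV[R]_n) ord0 j| < r ^+ w j.
  have : (fun y : 'rV[R]_n => `|y ord0 j|) @ x --> `|x ord0 j|.
    by apply: continuous_comp; [exact: coord_continuous|exact: norm_continuous].
  by move=> /cvgr_lt; exact.
by have := filter_forall (nbhs_filter x) near_r; apply: filterS => y /wboxP.
Qed.

(** Whatever is invariant under dilations then only has to be known near the origin. *)
Lemma dil_wbox r x : 0 < r -> exists2 eps : R, 0 < eps <= 1 & wbox r (dil eps x).
Proof.
move=> r0; pose m := Num.min r 1; have m0 : 0 < m by rewrite lt_min r0 ltr01.
pose s := \sum_i `|x ord0 i| / r ^+ w i; have s0 : 0 <= s.
  by apply: sumr_ge0 => i _; rewrite divr_ge0// exprn_ge0// ltW.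
(* As eps <= 1, eps^w_i |x_i| / r^w_i <= s / (s + 1) < 1. *)
exists (s + 1)^-1.
  by rewrite invr_gt0 ltr_wpDl//= invf_le1 ?ltr_wpDl// lerDr.
apply/wboxP => i; rewrite mxE normrM ger0_norm; last first.
  by rewrite exprn_ge0// invr_ge0 addr_ge0.
have t0 : 0 < s + 1 by rewrite ltr_wpDl.
apply: (@le_lt_trans _ _ ((s + 1)^-1 * `|x ord0 i|)).
  rewrite ler_wpM2r// -[leRHS]expr1; apply: ler_wiXn2l => //.
    by rewrite invr_ge0 ltW.
  by rewrite invf_le1// lerDr.
rewrite mulrC ltr_pdivrMr// mulrC -ltr_pdivrMr ?exprn_gt0//.
rewrite (@le_lt_trans _ _ s) ?ltrDl//.
rewrite /s (bigD1 i)//= lerDl; apply: sumr_ge0 => k _.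
by rewrite divr_ge0// exprn_ge0// ltW.
Qed.

Lemma dil_diag_affine eps : dil eps = diag_affine (fun i => eps ^+ w i) (fun=> 0).
Proof. by apply/funext => x; apply/rowP => i; rewrite !mxE addr0. Qed.

Lemma ge0_integral_dil eps B (h : 'rV[R]_n -> \bar R) : 0 < eps ->
  measurable B -> measurable_fun setT h -> (forall x, 0 <= h x)%E ->
  (\int[lebesgue_rV n]_(x in B) h x = (eps ^+ wsum w)%:E *
     \int[lebesgue_rV n]_(x in dil eps @^-1` B) h (dil eps x))%E.
Proof.
move=> e0 mB mh h0; rewrite dil_diag_affine /wsum -prodrXr.
apply: ge0_integral_diag_affine => // [i|]; first exact: exprn_gt0.
exact: measurable_funTS.
Qed.

Lemma measurable_dil eps : measurable_fun setT (dil eps).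
Proof. by rewrite dil_diag_affine; exact: measurable_diag_affine. Qed.

Lemma bigcup_wbox : \bigcup_k (wbox 1 `\` wbox (2^-1 ^+ k)) = wbox 1 `\ 0.
Proof.
apply/seteqP; split => [x [k _ [x1 xk]]|x [x1 x0]].
  split => // xx; apply: xk; rewrite xx; apply/wboxP => i.
  by rewrite mxE normr0 !exprn_gt0.
have [i xi] : exists i, x ord0 i != 0.
  apply: contrapT => nx; apply: x0; apply/rowP => i; rewrite mxE.
  by apply/eqP/negPn/negP => xi; apply: nx; exists i.
rewrite -normr_gt0 in xi; have [k ki] := exists_half_expr_lt xi.
exists k => //; split => // /wboxP/(_ i); rewrite ltNge => /negP; apply.
rewrite (le_trans _ (ltW ki))// -[leRHS]expr1; apply: ler_wiXn2l => //.
by apply: exprn_ile1 => //; rewrite invf_le1// ler1n.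
Qed.

(** Passing from the first shell to its dilate by 2^-k costs the Jacobian 2^(-k|w|) and at most 2^(k
    alpha). An inequality for contractions is enough, which suits a gradient whose components scale
    differently. *)
Lemma integral_wbox_lty (H : 'rV[R]_n -> \bar R) (alpha : R) :
  measurable_fun setT H -> (forall x, 0 <= H x)%E -> alpha < (wsum w)%:R ->
  (forall (eps : R) x, 0 < eps <= 1 ->
     (H (dil eps x) <= (eps `^ (- alpha))%:E * H x)%E) ->
  (\int[lebesgue_rV n]_(x in wbox 1%R `\` wbox (2^-1)%R) H x < +oo)%E ->
  (\int[lebesgue_rV n]_(x in wbox 1%R `\ 0%R) H x < +oo)%E.
Proof.
move=> mH H0 aw Heps Ioo.
pose q : R := 2^-1; have q0 : 0 < q by rewrite invr_gt0.
have q1 : q <= 1 by rewrite invf_le1// ler1n.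
pose I := fine (\int[lebesgue_rV n]_(x in wbox 1 `\` wbox q) H x)%E.
have IE : (\int[lebesgue_rV n]_(x in wbox 1 `\` wbox q) H x = I%:E)%E.
  by rewrite fineK// ge0_fin_numE// integral_ge0.
have mW r := measurable_wbox r.
have qle k : 0 <= q ^+ k <= 1.
  by apply/andP; split; [apply/exprn_ge0/ltW|apply: exprn_ile1 => //; exact: ltW].
rewrite -bigcup_wbox.
apply: (ge0_integral_geometric_lty mH H0 (a := I)
    (th := q ^+ wsum w * q `^ (- alpha))) => //.
- by move=> k; exact: measurableD.
- apply/nondecreasing_seqP => k; apply/subsetPset; apply: setDS.
  apply: subset_wbox; first by have /andP[] := qle k.+1.
  by rewrite exprS ler_piMl//; have /andP[] := qle k.
- by rewrite expr0 setDv integral_set0 ltry.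
- rewrite mulr_ge0 ?powR_ge0 ?exprn_ge0 ?(ltW q0)//= -powR_mulrn ?(ltW q0)//.
  rewrite -powRD; last by rewrite (gt_eqF q0) implybT.
  suff : q `^ ((wsum w)%:R - alpha) < 1 `^ ((wsum w)%:R - alpha) by rewrite powR1.
  apply: gt0_ltr_powR; rewrite ?subr_gt0 ?nnegrE ?(ltW q0)//.
  by rewrite invf_lt1// ltr1n.
- move=> k.
  have -> : (wbox 1 `\` wbox (q ^+ k.+1)) `\` (wbox 1 `\` wbox (q ^+ k)) =
      wbox (q ^+ k) `\` wbox (q ^+ k.+1).
    apply/seteqP; split => [x [[x1 xk1] nx]|x [xk xk1]].
      by split => //; apply: contrapT => xk; apply: nx.
    split; last by move=> [].
    by split => //; apply: subset_wbox xk; have /andP[] := qle k.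
  rewrite (@ge0_integral_dil (q ^+ k))//; [|exact: exprn_gt0|exact: measurableD].
  have -> : dil (q ^+ k) @^-1` (wbox (q ^+ k) `\` wbox (q ^+ k.+1)) =
      wbox 1 `\` wbox q.
    rewrite -(preimage_dil_wbox 1 (exprn_gt0 k q0)) mulr1.
    by rewrite -(preimage_dil_wbox q (exprn_gt0 k q0)) -exprSr.
  apply: (@le_trans _ _ (((q ^+ k) ^+ wsum w)%:E *
     \int[lebesgue_rV n]_(x in wbox 1%R `\` wbox q) (((q ^+ k) `^ (- alpha))%:E * H x))%E).
    apply: lee_wpmul2l; first by rewrite lee_fin; do 2 apply: exprn_ge0; exact: ltW.
    apply: ge0_le_integral => //.
    + exact: measurableD.
    + apply: measurable_funTS; apply: measurableT_comp => //; exact: measurable_dil.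
    + by apply: measurable_funTS; exact: measurable_funeM.
    + by move=> x _; apply: Heps; rewrite exprn_gt0//=; have /andP[] := qle k.
  have mWD : measurable (wbox 1 `\` wbox q) by exact: measurableD.
  rewrite (ge0_integralZl _ mWD) ?lee_fin ?powR_ge0//; last exact: measurable_funTS.
  rewrite IE -!EFinM lee_fin le_eqVlt; apply/orP; left; apply/eqP.
  by rewrite powRX ?(ltW q0)// exprMn -!exprM (mulnC k); ring.
Qed.

Lemma integral_wbox_homogeneous (H : 'rV[R]_n -> \bar R) (alpha eps r : R) :
  measurable_fun setT H -> (forall x, 0 <= H x)%E -> 0 < eps ->
  (forall x, H (dil eps x) = (eps `^ (- alpha))%:E * H x)%E ->
  (\int[lebesgue_rV n]_(x in wbox (eps * r)%R) H x =
   (eps `^ ((wsum w)%:R - alpha))%:E * \int[lebesgue_rV n]_(x in wbox r) H x)%E.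
Proof.
move=> mH H0 e0 Heps; have mW r' := measurable_wbox r'.
rewrite (ge0_integral_dil e0)// preimage_dil_wbox//.
rewrite (eq_integral (fun x => (eps `^ (- alpha))%:E * H x)%E) => [|x _]; last exact: Heps.
rewrite ge0_integralZl ?lee_fin ?powR_ge0//; last exact: measurable_funTS.
rewrite muleA -EFinM -powR_mulrn ?(ltW e0)//.
by rewrite -powRD// (gt_eqF e0) implybT.
Qed.

(* As |w| <= alpha, contracting the box does not decrease the integral of H:
   if finite, it is carried by arbitrarily small boxes. *)
Lemma integral_wbox_infty (H : 'rV[R]_n -> \bar R) (alpha rho : R) (y0 : 'rV[R]_n) :
  measurable_fun setT H -> (forall x, 0 <= H x)%E -> (wsum w)%:R <= alpha ->
  (forall (eps : R) x, 0 < eps -> (H (dil eps x) = (eps `^ (- alpha))%:E * H x)%E) ->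
  0 < rho -> y0 != 0 -> nbhs y0 [set y | (0 < H y)%E] ->
  ~ (\int[lebesgue_rV n]_(x in wbox rho) H x < +oo)%E.
Proof.
move=> mH H0 wa Heps rho0 y00 Hy0 rhooo; have mW r' := measurable_wbox r'.
(* Enlarging the box by 1 / eps makes it contain y0, and its integral stays finite by
   homogeneity. *)
have [eps /andP[e0 e1] epsy] := dil_wbox y0 rho0.
pose P := eps^-1 * rho; have P0 : 0 < P by rewrite mulr_gt0 ?invr_gt0.
have Py0 : wbox P y0.
  rewrite -(preimage_dil_wbox P e0) /P mulVKf ?gt_eqF//.
have homo t r : 0 < t -> _ := fun t0 => @integral_wbox_homogeneous H alpha t r
  mH H0 t0 (fun x => Heps t x t0).
have Poo : (\int[lebesgue_rV n]_(x in wbox P) H x < +oo)%E.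
  by rewrite homo ?invr_gt0// lte_mul_pinfty// lee_fin powR_ge0.
have [i yi] : exists i, y0 ord0 i != 0.
  apply: contrapT => nx; move/eqP : y00; apply; apply/rowP => i; rewrite mxE.
  by apply/eqP/negPn/negP => xi; apply: nx; exists i.
pose a := `|y0 ord0 i| / 2; have a0 : 0 < a by rewrite divr_gt0// normr_gt0.
pose m := Num.min 1 a; have m0 : 0 < m by rewrite lt_min ltr01 a0.
(* The box of parameter t P has i-th half-side at most a = |y0_i| / 2, so it misses a neighbourhood
   of y0. *)
pose t := Num.min 1 (m / P); have t0 : 0 < t by rewrite lt_min ltr01 divr_gt0.
have t1 : t <= 1 by rewrite ge_min lexx.
have tPm : t * P <= m by rewrite -ler_pdivlMr// ge_min lexx orbT.
(* J = t^(|w| - alpha) J + D with a factor at least 1 and J finite, whence D = 0. *)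
have D0 : (\int[lebesgue_rV n]_(x in wbox P `\` wbox (t * P)) H x = 0)%E.
  have Dge : (0 <= \int[lebesgue_rV n]_(x in wbox P `\` wbox (t * P)) H x)%E.
    exact: integral_ge0.
  have tPP : wbox (t * P) `<=` wbox P.
    by apply: subset_wbox; [exact/ltW/mulr_gt0|rewrite ler_piMl// ltW].
  have := ge0_integral_setD (lebesgue_rV n) mH H0 (mW (t * P)) (mW P) tPP.
  rewrite (homo t P t0)//.
  move: Dge; set J := (\int[_]_(x in wbox P) H x)%E in Poo *.
  have : (0 <= J)%E by exact: integral_ge0.
  move: J Poo => [J||]// _; rewrite lee_fin => J0.
  case: (\int[_]_(x in _ `\` _) H x)%E => [D||]//; rewrite lee_fin => D0.
  rewrite -EFinM -EFinD => -[JE]; congr EFin; apply/eqP; rewrite eq_le D0 andbT.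
  suff : 1 <= t `^ ((wsum w)%:R - alpha) by move=> /(ler_wpM2r J0); lra.
  rewrite -[leLHS](powRr0 t); apply: ger_powR; first by rewrite t0 t1.
  by rewrite subr_le0.
have : nbhs y0 ([set y | (0 < H y)%E] `&` wbox P `&` [set y | a < `|y ord0 i|]).
  apply: filterI; first by apply: filterI => //; exact: wbox_nbhs.
  have : (fun y : 'rV[R]_n => `|y ord0 i|) @ y0 --> `|y0 ord0 i|.
    by apply: continuous_comp; [exact: coord_continuous|exact: norm_continuous].
  by move=> /cvgr_gt; apply; rewrite /a; have := yi; rewrite -normr_gt0; lra.
move=> /nbhs_ballP[e /= e0' eP].
have mB := measurable_ball_rV y0 e0'.
(* This ball lies in the difference of the two boxes, where the integral of H is 0, and H is
   positive on it. *)
suff : vol (ball y0 e) = 0%E.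
  by have := lebesgue_rV_ball_gt0 y0 e0' => /[swap] ->; rewrite ltxx.
apply: (ge0_integral_eq0_measure0 mB mH H0); last by move=> x /eP[[]].
apply/eqP; rewrite eq_le integral_ge0// andbT -D0.
apply: ge0_subset_integral => //.
- exact: measurableD.
- exact: measurable_funTS.
move=> x /eP[[_ Px] /= ax]; split => // /wboxP/(_ i); rewrite ltNge => /negP; apply.
apply: le_trans (ltW ax); apply: (@le_trans _ _ m); last by rewrite ge_min lexx orbT.
have tP0 : 0 <= t * P by apply/ltW/mulr_gt0.
apply: (le_trans _ tPm); rewrite -[leRHS]expr1; apply: ler_wiXn2l => //.
by rewrite (le_trans tPm)// ge_min lexx.
Qed.

End dilations.

(** * Divergence near a noncritical zero *)

Section integral_near_zeros.
Context {R : realType} {n : nat}.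
Local Notation vol := (lebesgue_rV n : {measure set 'rV[R]_n -> \bar R}).
Variables (g : 'rV[R]_n -> R) (dg : 'I_n -> 'rV[R]_n -> R).
Hypothesis gdg : has_partials g dg.
Hypothesis cg : continuous g.
Hypothesis cdg : forall i, continuous (dg i).
Hypothesis mg : measurable_fun setT g.

(** Where 0 < |g| < r_k, H is at least m r_k^(-s) on a set of volume at least c r_k, so its integral
    there is at least m c; yet these sets decrease to the empty set. *)
Lemma integral_near_zero_infty x0 j V (H : 'rV[R]_n -> \bar R) (m s : R) :
  g x0 = 0 -> dg j x0 != 0 -> nbhs x0 V -> measurable V ->
  measurable_fun setT H -> (forall x, 0 <= H x)%E -> 1 <= s -> 0 < m ->
  (forall x, V x -> g x != 0 -> ((m * `|g x| `^ (- s))%:E <= H x)%E) ->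
  ~ (\int[lebesgue_rV n]_(x in V) H x < +oo)%E.
Proof.
move=> gx0 dgx0 Vx0 mV mH H0 s1 m0 mgH Voo.
have [c c0 [r0 r00 cP]] := sublevel_ge gdg cg cdg mg gx0 dgx0 Vx0 mV.
(* r_k < r0 gives the lower bound on the volume, r_k <= 1 gives r_k^(-s) >= r_k^(-1). *)
pose r1 := Num.min 1 (r0 / 2); have r10 : 0 < r1 by rewrite lt_min ltr01 divr_gt0.
pose q : R := 2^-1; have q0 : 0 < q by rewrite invr_gt0.
have q1 : q <= 1 by rewrite invf_le1// ler1n.
pose r k := r1 * q ^+ k.
have rpos k : 0 < r k by rewrite mulr_gt0// exprn_gt0.
have rr1 k : r k <= r1.
  by rewrite ler_piMr ?(ltW r10)//; apply: exprn_ile1 => //; exact: ltW.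
have rr0 k : r k < r0.
  rewrite (le_lt_trans (rr1 k))// (@le_lt_trans _ _ (r0 / 2)) ?ge_min ?lexx ?orbT//.
  by rewrite ltr_pdivrMr// ltr_pMr// ltr1n.
have r_le1 k : r k <= 1 by rewrite (le_trans (rr1 k))// ge_min lexx.
pose S k := V `&` [set x | 0 < `|g x| < r k].
have mS k : measurable (S k) by apply: measurableI => //; exact: measurable_norm_itv.
apply: (@ge0_integral_shrinking _ _ _ (lebesgue_rV n) H mH H0 S (m * c)) => //.
- apply/nonincreasing_seqP => k; apply/subsetPset => x [Vx /= /andP[gx xr]].
  split => //=; rewrite gx (lt_le_trans xr)// /r exprS mulrCA ler_piMl//.
  exact: (ltW (rpos k)).
- apply/seteqP; split => // x Sx; have [_ /= /andP[gx _]] := Sx 0%N I.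
  have [k kx] := exists_half_expr_lt gx.
  have [_ /= /andP[_]] := Sx k I; rewrite ltNge => /negP; apply.
  rewrite (le_trans _ (ltW kx))// ler_piMl ?exprn_ge0 ?(ltW q0)//.
  by rewrite ge_min lexx.
- apply: le_lt_trans Voo; apply: ge0_subset_integral => //.
  + exact: measurable_funTS.
  + exact: subIsetl.
- exact: mulr_gt0.
- move=> k; apply: (@le_trans _ _ ((m * (r k) `^ (- s))%:E * vol (S k))%E); last first.
    apply: ge0_integral_ge_cst => //; first by rewrite mulr_ge0 ?powR_ge0 ?(ltW m0).
    move=> x [Vx /= /andP[gx xr]]; apply: le_trans (mgH x Vx _); last by rewrite -normr_gt0.
    rewrite lee_fin ler_wpM2l ?(ltW m0)//; apply: le_powR_neg => //; last exact: ltW.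
    exact: le_trans s1.
  apply: (@le_trans _ _ ((m * (r k) `^ (- s))%:E * (c * r k)%:E)%E); last first.
    apply: lee_wpmul2l; first by rewrite lee_fin mulr_ge0 ?powR_ge0 ?(ltW m0).
    by apply: cP; rewrite rpos rr0.
  rewrite -EFinM lee_fin mulrACA ler_peMr ?mulr_ge0 ?(ltW m0) ?(ltW c0)//.
  have <- : r k `^ (- 1) * r k = 1.
    by rewrite powR_inv1 ?(ltW (rpos k))// mulVf ?gt_eqF.
  rewrite ler_wpM2r ?(ltW (rpos k))//; apply: ger_powR; first by rewrite rpos r_le1.
  by rewrite lerN2.
Qed.

End integral_near_zeros.

(** * Quasi-homogeneous functions with an isolated critical point *)

Section quasi_homogeneous_functions.
Context {R : realType} {n : nat}.
Local Notation e i := (delta_mx ord0 i : 'rV[R]_n).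
Variables (g : 'rV[R]_n -> R) (dg : 'I_n -> 'rV[R]_n -> R).
Hypothesis gdg : has_partials g dg.
Hypothesis cdg : forall i, continuous (dg i).
Variables (w : 'I_n -> nat) (d : nat).
Hypothesis n0 : (0 < n)%N.
Hypothesis w0 : forall i, (0 < w i)%N.
Hypothesis qh : quasi_homogeneous g w d.
Hypothesis crit : isolated_critical_point g 0.
Hypothesis dep : forall i, depends_on g i.

(** Restriction to a line makes the one-variable chain rule available. *)
Lemma is_derive_lineP (h : 'rV[R]_n -> R) i x l :
  is_derive x (e i) (h : 'rV[R]_n -> R^o) l <->
  is_derive (0 : R) 1 ((fun s => h (s *: e i + x)) : R -> R^o) l.
Proof.
have E : (fun t : R => t^-1 *: (((fun s => h (s *: e i + x)) \o shift 0) (t *: 1) -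
                     h (0 *: e i + x) : R^o)) =
    (fun t : R => t^-1 *: (((h : 'rV[R]_n -> R^o) \o shift x) (t *: e i) - h x)).
  apply/funext => t /=; rewrite scale0r add0r addr0.
  by have -> : t *: (1 : R^o) = t by exact: mulr1.
by split=> -[D V]; apply: DeriveDef; move: D V; rewrite /derivable /derive E.
Qed.

Lemma grad_has_partials x : grad g x = \row_i dg i x.
Proof.
by apply/rowP => i; rewrite !mxE; have [_ ->] := gdg i x.
Qed.

Lemma dil_line eps i s x : dil w eps (s *: e i + x) = (eps ^+ w i * s) *: e i + dil w eps x.
Proof.
apply/rowP => j; rewrite !mxE mulrDr; congr (_ + _).
by rewrite eqxx/=; case: eqP => [->|_]; rewrite ?mulr1 ?mulr0.
Qed.

(** The identity g(D_eps x) = eps^d g(x) differentiated along e_i, by the chain rule on the left. *)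
Lemma partial_dil i eps x : 0 < eps ->
  eps ^+ w i * dg i (dil w eps x) = eps ^+ d * dg i x.
Proof.
move=> e0; pose F s := g (dil w eps (s *: e i + x)).
have FE1 : F = (fun u => g (u *: e i + dil w eps x)) \o (fun s => eps ^+ w i * s).
  by apply/funext => s; rewrite /F dil_line.
have FE2 : F = (fun s => eps ^+ d *: (g (s *: e i + x) : R^o)).
  by apply/funext => s; rewrite /F; exact: qh.
have D1 : is_derive (0 : R) 1 (F : R -> R^o) (dg i (dil w eps x) * eps ^+ w i).
  rewrite FE1; apply: is_derive1_comp.
    by rewrite mulr0; exact/is_derive_lineP.
  by apply: is_derive_eq (is_deriveZ _ (is_derive_id _ _)) _; rewrite /GRing.scale/= mulr1.
have D2 : is_derive (0 : R) 1 (F : R -> R^o) (eps ^+ d *: (dg i x : R^o)).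
  by rewrite FE2; apply: is_deriveZ; exact/is_derive_lineP.
by have [_ E2] := D2; have [_ E1] := D1; rewrite mulrC; exact: etrans (esym E1) E2.
Qed.

Lemma partial0 i : dg i 0 = 0.
Proof. by have [/rowP/(_ i)] := crit; rewrite grad_has_partials !mxE. Qed.

(* Otherwise the i-th partial derivative of g ^+ 3 vanishes identically, and
   cubing is injective. *)
Lemma exists_partial_neq0 i : exists y, g y != 0 /\ dg i y != 0.
Proof.
apply: contrapT => nex.
have [x [y [xy gxy]]] := dep i; apply: gxy.
have yE : y = (y ord0 i - x ord0 i) *: e i + x.
  apply/rowP => j; rewrite !mxE eqxx/=.
  by case: eqP => [->|/eqP ji]; rewrite ?mulr1 ?mulr0 ?addrNK// add0r xy.
have cube : has_partials (fun z => g z ^+ 3) (fun j z => 3%:R * g z ^+ 2 * dg j z).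
  move=> j z; have := is_deriveX 3 (gdg j z).
  have -> : (g : 'rV[R]_n -> R^o) ^+ 3 = (fun z => g z ^+ 3).
    by apply/funext => y'; rewrite exprfctE.
  by [].
have [s _] := has_partials_MVT i x (y ord0 i - x ord0 i) cube.
rewrite -yE; set z := _ + x.
have -> : 3%:R * g z ^+ 2 * dg i z = 0.
  have [->|gz] := eqVneq (g z) 0; first by rewrite expr0n/= mulr0 mul0r.
  have [->|dz] := eqVneq (dg i z) 0; first by rewrite mulr0.
  by exfalso; apply: nex; exists z.
rewrite mul0r => /eqP; rewrite subr_eq0 => /eqP/esym gc.
apply/eqP; rewrite -subr_eq0; move/eqP: gc; rewrite -subr_eq0.
(* The factor a^2 + a b + b^2 written as a sum of squares vanishes only for a = b = 0. *)
rewrite (_ : g x ^+ 3 - g y ^+ 3 =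
  (g x - g y) * (((2 * g x + g y) ^+ 2 + 3 * g y ^+ 2) / 4)); last by field.
rewrite mulf_eq0 => /orP[//|]; rewrite mulf_eq0 invr_eq0 pnatr_eq0 orbF.
move=> /eqP s0; have := sqr_ge0 (2 * g x + g y); have := sqr_ge0 (g y) => p1 p2.
have /eqP : g y ^+ 2 = 0 by lra.
have /eqP : (2 * g x + g y) ^+ 2 = 0 by lra.
by rewrite !sqrf_eq0 => /eqP gxy' /eqP gy; apply/eqP; lra.
Qed.

Lemma weight_lt_degree i : (w i < d)%N.
Proof.
rewrite ltnNge; apply/negP => dw.
have [y [_ dy]] := exists_partial_neq0 i.
have : nbhs (0 : 'rV[R]_n) [set x | `|dg i x| < `|dg i y|].
  have : (fun x => `|dg i x|) @ (0 : 'rV[R]_n) --> `|dg i 0|.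
    by apply: continuous_comp; [exact: cdg|exact: norm_continuous].
  by move=> /cvgr_lt; apply; rewrite partial0 normr0 normr_gt0.
move=> /(nbhs0_wbox w0)[r /andP[r0 _] rP].
have [eps /andP[e0 e1] /rP/=] := dil_wbox w0 y r0.
apply/negP; rewrite -leNgt.
have <- : eps ^+ (w i - d) * dg i (dil w eps y) = dg i y.
  apply: (mulfI (lt0r_neq0 (exprn_gt0 d e0))).
  by rewrite -(partial_dil i y e0) mulrA -exprD subnKC.
rewrite normrM ler_piMl// ger0_norm ?exprn_ge0 ?(ltW e0)//.
by apply: exprn_ile1 => //; exact: ltW.
Qed.

Lemma exists_wmax : exists i, wmax w = w i.
Proof.
have [|i wi] := @bigop.eq_bigmax _ w; first by rewrite card_ord.
by exists i.
Qed.

Lemma wmax_lt_degree : (wmax w < d)%N.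
Proof. by have [i ->] := exists_wmax; exact: weight_lt_degree. Qed.

(** The dilation by 2 fixes the origin, so g 0 = 2^d g 0 with d > 0. *)
Lemma quasi_homogeneous0 : g 0 = 0.
Proof.
have := qh (ltr0Sn R 1) 0; rewrite (_ : \row_i _ = 0); last first.
  by apply/rowP => i; rewrite !mxE mulr0.
have d0 : (0 < d)%N by exact: leq_trans wmax_lt_degree.
move=> /eqP; rewrite -subr_eq0 -{1}(mul1r (g 0)) -mulrBl mulf_eq0.
case/orP => [|/eqP//]; rewrite subr_eq0 => /eqP h.
have : (1 : R) < 2 ^+ d by rewrite exprn_egt1 ?ltr1n// -lt0n.
by rewrite -h ltxx.
Qed.

(** Isolation of the critical point becomes global: x contracts into the punctured neighbourhood,
    and by [partial_dil] the vanishing of a partial derivative is invariant under dilations. *)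
Lemma exists_partial_neq0_off0 x : x != 0 -> exists j, dg j x != 0.
Proof.
move=> x0; have [_] := crit; rewrite /dnbhs /within/= => /(nbhs0_wbox w0)[r /andP[r0 _] rP].
have [eps /andP[e0 e1] /rP/=] := dil_wbox w0 x r0.
have ei i : eps ^+ w i != 0 by rewrite expf_neq0 ?gt_eqF.
have : dil w eps x != 0.
  apply: contra x0 => /eqP/rowP dx0; apply/eqP/rowP => i.
  have /eqP := dx0 i; rewrite !mxE mulf_eq0 (negbTE (ei i)) => /eqP//.
move=> /[swap] /[apply] gx; apply: contrapT => nj.
move/eqP: gx; apply; rewrite grad_has_partials; apply/rowP => i; rewrite !mxE.
have dix : dg i x = 0 by apply/eqP/negPn/negP => dix; apply: nj; exists i.
apply/eqP; have /eqP := partial_dil i x e0; rewrite dix mulr0 mulf_eq0.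
by rewrite (negbTE (ei i)).
Qed.

End quasi_homogeneous_functions.

(** * Euclidean norm *)

Section euclidean_norm.
Context {R : realType} {n : nat}.
Implicit Types v : 'rV[R]_n.

Lemma enorm_ge0 v : 0 <= enorm v.
Proof. exact: sqrtr_ge0. Qed.

Lemma enormZ (a : R) v : enorm (a *: v) = `|a| * enorm v.
Proof.
rewrite /enorm; under eq_bigr do rewrite mxE exprMn.
by rewrite -mulr_sumr sqrtrM ?sqr_ge0// sqrtr_sqr.
Qed.

Lemma le_enorm v v' : (forall i, `|v ord0 i| <= `|v' ord0 i|) -> enorm v <= enorm v'.
Proof.
move=> vv'; rewrite /enorm ler_wsqrtr//; apply: ler_sum => i _.
by rewrite -[leLHS](real_normK (num_real _)) -[leRHS](real_normK (num_real _)) lerXn2r ?nnegrE.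
Qed.

Lemma norm_coord_le_enorm v i : `|v ord0 i| <= enorm v.
Proof.
rewrite -[leLHS]sqrtr_sqr /enorm ler_wsqrtr//.
by rewrite (bigD1 i)//= lerDl; apply: sumr_ge0 => j _; exact: sqr_ge0.
Qed.

End euclidean_norm.

(** * The gradient of |g|^(-kappa) and its densities *)

Section gradient_of_negative_power.
Context {R : realType} {n : nat}.
Variables (g : 'rV[R]_n -> R) (dg : 'I_n -> 'rV[R]_n -> R).
Hypothesis gdg : has_partials g dg.
Hypothesis cg : continuous g.
Hypothesis cdg : forall i, continuous (dg i).
Hypothesis mg : measurable_fun setT g.
Hypothesis mdg : forall i, measurable_fun setT (dg i).
Variables (kappa : R).
Hypothesis kappa0 : 0 < kappa.

Local Notation dgv x := (\row_i dg i x : 'rV[R]_n).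

Lemma powR_sqr (x b : R) : (x ^+ 2) `^ b = `|x| `^ (2 * b).
Proof. by rewrite -(real_normK (num_real x)) powRX// powRrM powRAC powR_mulrn ?powR_ge0. Qed.

Lemma grad_neg_power x : g x != 0 ->
  grad (neg_power g kappa) x =
  (- kappa * (g x ^+ 2) `^ (- (kappa / 2) - 1) * g x) *: dgv x.
Proof.
move=> gx; apply/rowP => i; rewrite !mxE.
(* |g|^-kappa = (g^2)^(-kappa/2), which avoids a discussion on the sign of g *)
pose b := - (kappa / 2).
have NE y : neg_power g kappa y = (g y ^+ 2) `^ b.
  by rewrite powR_sqr /neg_power; congr (_ `^ _); rewrite /b; field.
apply: derive_val; apply/is_derive_lineP.
have -> : (fun s => neg_power g kappa (s *: delta_mx ord0 i + x)) =
    (@powR R ^~ b) \o (fun s => g (s *: delta_mx ord0 i + x) ^+ 2).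
  by apply/funext => s; rewrite NE.
pose F : R -> R^o := fun s => g (s *: delta_mx ord0 i + x).
have D1 : is_derive (0 : R) 1 F (dg i x) by exact/is_derive_lineP.
have F0 : F 0 = g x by rewrite /F scale0r add0r.
have D2 : is_derive (0 : R) 1 (fun s => F s ^+ 2 : R^o) (2 * g x * dg i x).
  by have := is_deriveX 2 D1; rewrite F0.
have gx2 : 0 < F 0 ^+ 2 by rewrite F0 exprn_even_gt0.
have D3 := @is_derive1_powR R b _ gx2.
have D4 := @is_derive1_comp R (@powR R ^~ b) (fun s => F s ^+ 2) 0 _ _ D3 D2.
apply: (is_derive_eq D4).
by rewrite F0 /b; field.
Qed.

Lemma enorm_grad_neg_power x : g x != 0 ->
  enorm (grad (neg_power g kappa) x) =
  kappa * `|g x| `^ (- (kappa + 1)) * enorm (dgv x).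
Proof.
move=> gx; rewrite grad_neg_power// enormZ; congr (_ * _).
rewrite !normrM normrN (gtr0_norm kappa0) -mulrA; congr (_ * _).
rewrite ger0_norm ?powR_ge0// powR_sqr -[X in _ * X]powRr1//.
rewrite -powRD; last by rewrite normr_eq0 gx implybT.
by congr (_ `^ _); field.
Qed.

(* Off the zero set this is |grad |g|^-kappa|^p; at a zero the convention
   0 `^ a = 0 for a != 0 makes it vanish when p != 0. *)
Definition grad_density (p : R) (x : 'rV[R]_n) : R :=
  (kappa * `|g x| `^ (- (kappa + 1)) * enorm (dgv x)) `^ p.

(** A single component of the gradient scales exactly under dilations; it serves as a minorant of
    [grad_density] in the divergence proofs. *)
Definition partial_density (i : 'I_n) (p : R) (x : 'rV[R]_n) : R :=
  (kappa * `|g x| `^ (- (kappa + 1)) * `|dg i x|) `^ p.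

Lemma measurable_grad_density p : measurable_fun setT (EFin \o grad_density p).
Proof.
apply/measurable_EFinP; apply: (measurableT_comp (measurable_powR p)).
apply: measurable_funM.
  apply: measurable_funM => //; apply: (measurableT_comp (measurable_powR _)).
  exact: measurableT_comp.
rewrite /enorm; apply: measurableT_comp.
  by apply: continuous_measurable_fun; exact: sqrt_continuous.
apply: measurable_sum => i; apply: measurable_funX.
by under eq_fun do rewrite mxE; exact: mdg.
Qed.

Lemma measurable_partial_density i p :
  measurable_fun setT (EFin \o partial_density i p).
Proof.
apply/measurable_EFinP; apply: (measurableT_comp (measurable_powR p)).
apply: measurable_funM; last exact: measurableT_comp.
apply: measurable_funM => //; apply: (measurableT_comp (measurable_powR _)).
exact: measurableT_comp.
Qed.

Lemma grad_density_ge0 p x : (0 <= (EFin \o grad_density p) x)%E.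
Proof. by rewrite lee_fin powR_ge0. Qed.

Lemma partial_density_ge0 i p x : (0 <= (EFin \o partial_density i p) x)%E.
Proof. by rewrite lee_fin powR_ge0. Qed.

Lemma partial_density_le i p x : 0 <= p -> partial_density i p x <= grad_density p x.
Proof.
have c0 : 0 <= kappa * `|g x| `^ (- (kappa + 1)).
  by rewrite mulr_ge0 ?powR_ge0// ltW.
move=> p0; apply: ge0_ler_powR => //.
- by rewrite nnegrE; exact: mulr_ge0.
- by rewrite nnegrE; apply: mulr_ge0 => //; exact: enorm_ge0.
by rewrite ler_wpM2l//; have := norm_coord_le_enorm (dgv x) i; rewrite mxE.
Qed.

Lemma grad_density0 p x : p != 0 -> g x = 0 -> grad_density p x = 0.
Proof.
move=> p0 gx; rewrite /grad_density gx normr0 powR0; last first.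
  by rewrite oppr_eq0 gt_eqF// addr_gt0.
by rewrite mulr0 mul0r powR0.
Qed.

Lemma measurable_zeros : measurable (zeros g).
Proof.
rewrite -[X in measurable X]setTI (_ : zeros g = g @^-1` [set 0])//.
exact: mg.
Qed.

(** For p > 0 the density vanishes on the zeros of g, so integrating over all of U changes
    nothing. *)
Lemma grad_Lp_near0P p : 0 < p -> grad_Lp_near0 g kappa p <->
  exists U, [/\ nbhs (0 : 'rV[R]_n) U, measurable U &
    (\int[lebesgue_rV n]_(x in U) (grad_density p x)%:E < +oo)%E].
Proof.
move=> p0; have mG := measurable_grad_density p; have G0 := grad_density_ge0 p.
have E U x : (U `&` ~` zeros g) x ->
    enorm (grad (neg_power g kappa) x) `^ p = grad_density p x.
  by move=> [_ /eqP gx]; rewrite enorm_grad_neg_power.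
have mUZ U : measurable U -> measurable (U `&` ~` zeros g).
  by move=> mU; apply: measurableI => //; apply: measurableC; exact: measurable_zeros.
have intE U : measurable U -> (\int[lebesgue_rV n]_(x in U) (grad_density p x)%:E =
    \int[lebesgue_rV n]_(x in U `&` ~` zeros g) (grad_density p x)%:E)%E.
  move=> mU.
  rewrite (ge0_integral_setD (lebesgue_rV n) mG G0 (mUZ U mU) mU); last exact: subIsetl.
  rewrite [X in (_ + X)%E]integral0_eq ?adde0// => x [Ux nUx].
  rewrite /= grad_density0 ?gt_eqF//; apply: contrapT => gx; exact: nUx.
split=> -[U [U0 mU H]]; exists U; split => //.
- rewrite intE//; have /integrableP[_] := H.
  rewrite (eq_integral (fun x => (grad_density p x)%:E))// => x /set_mem UZ.
  by rewrite abse_EFin ger0_norm ?powR_ge0// (E U).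
- apply/integrableP; split.
    apply: (eq_measurable_fun (EFin \o grad_density p)); last exact: measurable_funTS.
    by move=> x /set_mem UZ /=; rewrite (E U).
  rewrite (eq_integral (fun x => (grad_density p x)%:E)) -?intE// => x /set_mem UZ.
  by rewrite abse_EFin ger0_norm ?powR_ge0// (E U).
Qed.

End gradient_of_negative_power.

(** * Bounds for continuous functions on compact sets *)

Section compact_bounds.
Context {R : realType} {n : nat}.
Implicit Types (C : set 'rV[R]_n) (h : 'rV[R]_n -> R).

Lemma compact_norm_le C h : compact C -> continuous h ->
  exists2 M, 0 <= M & forall x, C x -> `|h x| <= M.
Proof.
move=> cC ch; have [C0|/set0P C0] := eqVneq C set0.
  by exists 0 => // x; rewrite C0.
have ch' : {within C, continuous (fun x => `|h x|)}.
  apply: continuous_subspaceT => x.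
  by apply: continuous_comp; [exact: ch|exact: norm_continuous].
have [c _ cP] := EVT_max_rV C0 cC ch'.
by exists `|h c| => // x Cx; apply: cP; rewrite inE.
Qed.

Lemma compact_norm_ge C h : compact C -> continuous h ->
  (forall x, C x -> h x != 0) -> exists2 m, 0 < m & forall x, C x -> m <= `|h x|.
Proof.
move=> cC ch h0; have [C0|/set0P C0] := eqVneq C set0.
  by exists 1 => // x; rewrite C0.
have ch' : {within C, continuous (fun x => `|h x|)}.
  apply: continuous_subspaceT => x.
  by apply: continuous_comp; [exact: ch|exact: norm_continuous].
have [c cC' cP] := EVT_min_rV C0 cC ch'.
exists `|h c|; first by rewrite normr_gt0 h0//; exact: set_mem.
by move=> x Cx; apply: cP; rewrite inE.
Qed.

End compact_bounds.

(** * The integrability threshold and the log-canonical threshold *)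

Section threshold.
Context {R : realType} {n : nat}.
Local Notation vol := (lebesgue_rV n : {measure set 'rV[R]_n -> \bar R}).
Variables (g : 'rV[R]_n -> R) (dg : 'I_n -> 'rV[R]_n -> R).
Hypothesis gdg : has_partials g dg.
Hypothesis cg : continuous g.
Hypothesis cdg : forall i, continuous (dg i).
Hypothesis mg : measurable_fun setT g.
Hypothesis mdg : forall i, measurable_fun setT (dg i).
Variables (w : 'I_n -> nat) (d : nat).
Hypothesis n0 : (0 < n)%N.
Hypothesis w0 : forall i, (0 < w i)%N.
Hypothesis qh : quasi_homogeneous g w d.
Hypothesis crit : isolated_critical_point g 0.
Hypothesis dep : forall i, depends_on g i.
Variable kappa : R.
Hypothesis kappa0 : 0 < kappa.

Local Notation dgv x := (\row_i dg i x : 'rV[R]_n).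
Local Notation gd := (grad_density g dg kappa).
Local Notation pd := (partial_density g dg kappa).

Let wd i : (w i < d)%N. Proof. exact: (weight_lt_degree gdg cdg w0 qh crit dep). Qed.
Let wmd : (wmax w < d)%N. Proof. exact: (wmax_lt_degree gdg cdg n0 w0 qh crit dep). Qed.
Let g00 : g 0 = 0. Proof. exact: (quasi_homogeneous0 gdg cdg n0 w0 qh crit dep). Qed.

Let norm_g_dil (b eps : R) x : 0 < eps ->
  `|g (dil w eps x)| `^ b = eps `^ (d%:R * b) * `|g x| `^ b.
Proof.
move=> e0; have -> : g (dil w eps x) = eps ^+ d * g x by exact: qh.
rewrite normrM ger0_norm ?exprn_ge0 ?(ltW e0)// powRM ?exprn_ge0 ?(ltW e0)//.
by rewrite -powR_mulrn ?(ltW e0)// powRrM.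
Qed.

Let norm_dg_dil (eps : R) i x : 0 < eps ->
  `|dg i (dil w eps x)| = eps ^+ (d - w i) * `|dg i x|.
Proof.
move=> e0; have := partial_dil gdg qh i x e0.
have -> : eps ^+ d = eps ^+ w i * eps ^+ (d - w i) by rewrite -exprD subnKC// ltnW.
rewrite -mulrA => /(mulfI (lt0r_neq0 (exprn_gt0 _ e0))) ->.
by rewrite normrM ger0_norm// exprn_ge0// ltW.
Qed.

(** Origin of the exponent: |g|^(-(kappa+1)) contributes - d (kappa + 1), a derivative in a variable
    of weight k contributes d - k. *)
Let expE (eps : R) (k : nat) : 0 < eps -> (k <= d)%N ->
  eps `^ (d%:R * - (kappa + 1)) * eps ^+ (d - k) =
  eps `^ (- (kappa * d%:R + k%:R)).
Proof.
move=> e0 kd; rewrite -powR_mulrn ?(ltW e0)// -powRD; last by rewrite (gt_eqF e0) implybT.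
by rewrite natrB//; congr (_ `^ _); ring.
Qed.

Lemma partial_density_dil i p eps x : 0 < eps ->
  pd i p (dil w eps x) = eps `^ (- (p * (kappa * d%:R + (w i)%:R))) * pd i p x.
Proof.
move=> e0; rewrite /partial_density norm_g_dil// norm_dg_dil//.
set a := `|g x| `^ _; have a0 : 0 <= a by exact: powR_ge0.
rewrite (_ : kappa * _ * _ = eps `^ (- (kappa * d%:R + (w i)%:R)) *
  (kappa * a * `|dg i x|)); last first.
  by rewrite -(expE e0 (ltnW (wd i))); ring.
rewrite powRM ?powR_ge0//; last by do 2 apply: mulr_ge0 => //; exact: ltW.
by rewrite -powRrM; congr (_ `^ _ * _); ring.
Qed.

(** For eps <= 1 every factor eps^(d - w_i) is at most eps^(d - w_max); when the weights differ only
    this inequality survives. *)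
Lemma grad_density_dil p eps x : 0 <= p -> 0 < eps <= 1 ->
  gd p (dil w eps x) <= eps `^ (- (p * (kappa * d%:R + (wmax w)%:R))) * gd p x.
Proof.
move=> p0 /andP[e0 e1]; rewrite /grad_density norm_g_dil//.
set a := `|g x| `^ _; have a0 : 0 <= a by exact: powR_ge0.
have eg0 := enorm_ge0 (dgv x); have kap0 := ltW kappa0.
have en : enorm (dgv (dil w eps x)) <= eps ^+ (d - wmax w) * enorm (dgv x).
  rewrite -[X in _ <= X * _]ger0_norm ?exprn_ge0 ?(ltW e0)// -enormZ.
  apply: le_enorm => i; rewrite !mxE norm_dg_dil// normrM ler_wpM2r//.
  rewrite ger0_norm ?exprn_ge0 ?(ltW e0)//; apply: ler_wiXn2l => //; first exact: ltW.
  by apply: leq_sub2l; exact: (bigop.leq_bigmax (F := w)).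
have c0 : 0 <= kappa * a * enorm (dgv x) by do 2 apply: mulr_ge0 => //.
rewrite (_ : _ `^ (- (p * _)) = (eps `^ (- (kappa * d%:R + (wmax w)%:R))) `^ p); last first.
  by rewrite -powRrM; congr (_ `^ _); ring.
rewrite -powRM ?powR_ge0//; apply: ge0_ler_powR => //.
- rewrite nnegrE; apply: mulr_ge0; last exact: enorm_ge0.
  by apply: mulr_ge0 => //; apply: mulr_ge0 => //; exact: powR_ge0.
- by rewrite nnegrE; apply: mulr_ge0 => //; exact: powR_ge0.
rewrite -(expE e0 (ltnW wmd)).
set b := eps `^ _; have b0 : 0 <= b by exact: powR_ge0.
rewrite (_ : b * _ * _ = kappa * (b * a) * (eps ^+ (d - wmax w) * enorm (dgv x))); last by ring.
by apply: ler_wpM2l => //; do 2 apply: mulr_ge0 => //.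
Qed.

Lemma unit_shell_compact : compact ([set x : 'rV[R]_n | forall i, `|x ord0 i| <= 1]
  `&` ~` wbox w 2^-1).
Proof.
apply: compact_closedI.
  have := @rV_compact R n (fun=> `[-1, 1]%classic) (fun=> @segment_compact R _ _).
  congr compact; apply/seteqP; split => x x1 i; have := x1 i;
    by rewrite /= in_itv/= -ler_norml.
by apply: open_closedC; rewrite openE => x; exact: wbox_nbhs.
Qed.

Local Notation cube := [set x : 'rV[R]_n | forall i, `|x ord0 i| <= 1].

Lemma wbox1_cube : wbox w 1 `<=` cube.
Proof.
move=> x /wboxP x1 i; rewrite ltW//.
by have := x1 i; rewrite expr1n.
Qed.

(** On the compact shell the density is at most a constant times |g|^(-p(kappa+1)). Either g has no
    zero there and |g| is bounded below, or the linear sublevel bound applies, every point of the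
    shell being noncritical. *)
Lemma grad_density_shell_lty p : 0 < p ->
  zeros_trivial g \/ p * (kappa + 1) < 1 ->
  (\int[lebesgue_rV n]_(x in wbox w 1%R `\` wbox w (2^-1)%R) (gd p x)%:E < +oo)%E.
Proof.
move=> p0 zp; have cC := unit_shell_compact; set C := _ `&` _ in cC.
have kap1 : 0 < kappa + 1 by rewrite addr_gt0.
set S := wbox w 1 `\` _.
have mS : measurable S by apply: measurableD; exact: measurable_wbox.
have SC : S `<=` C by move=> x [x1 x2]; split => //; exact: wbox1_cube.
have Soo : (vol S < +oo)%E.
  rewrite (le_lt_trans _ (lebesgue_rV_wbox_lty w ltr01))//.
  apply: le_measure; rewrite ?inE//; first exact: measurable_wbox.
  by move=> x [].
have C0 x : C x -> x != 0.
  move=> [_ nx]; apply/eqP => x0; apply: nx; apply/wboxP => i.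
  by rewrite x0 mxE normr0 exprn_gt0// invr_gt0.
have [B B0 BP] : exists2 B, 0 <= B & forall x, C x -> enorm (dgv x) <= B.
  have := fun i => compact_norm_le cC (@cdg i).
  move=> /(_ _)/cid2 bnd; pose M i := sval (bnd i).
  pose v : 'rV[R]_n := \row_i M i.
  exists (enorm v) => [|x Cx]; first exact: enorm_ge0.
  apply: le_enorm => i; rewrite !mxE /M; case: (bnd i) => /= Mi Mi0 MiP.
  by rewrite (ger0_norm Mi0) MiP.
have gdle x : C x -> gd p x <= (kappa * B) `^ p * `|g x| `^ (- (p * (kappa + 1))).
  move=> Cx; rewrite /grad_density -mulrN (mulrC p) powRrM -powRM ?powR_ge0//; last first.
    by rewrite mulr_ge0// ltW.
  apply: ge0_ler_powR; first exact: ltW.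
  - rewrite nnegrE; apply: mulr_ge0; last exact: enorm_ge0.
    by apply: mulr_ge0; [exact: ltW|exact: powR_ge0].
  - by rewrite nnegrE; apply: mulr_ge0; [apply: mulr_ge0 => //; exact: ltW|exact: powR_ge0].
  rewrite (mulrAC kappa B).
  apply: ler_wpM2l; last exact: BP.
  by apply: mulr_ge0; [exact: ltW|exact: powR_ge0].
have mG := measurable_grad_density mg mdg kappa p.
have G0 := grad_density_ge0 g dg kappa p.
case: zp => [[U U0 UZ]|s1].
  (* A zero on the shell would be contracted to a nonzero zero inside U. *)
  have gC x : C x -> g x != 0.
    move=> Cx; have [r /andP[r0 _] rU] := nbhs0_wbox w0 U0.
    have [eps /andP[e0 _] /rU Ueps] := dil_wbox w0 x r0.
    apply/eqP => gx; have : (zeros g `&` U) (dil w eps x).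
      by split => //; rewrite /zeros/=; rewrite [LHS](qh e0) gx mulr0.
    rewrite UZ => /= dx0; have := C0 x Cx => /eqP; apply.
    apply/rowP => i; have /rowP/(_ i) := dx0; rewrite !mxE => /eqP.
    by rewrite mulf_eq0 expf_eq0 (gt_eqF e0) andbF/= => /eqP.
  have [m m0 mP] := compact_norm_ge cC cg gC.
  pose M := (kappa * B) `^ p * m `^ (- (p * (kappa + 1))).
  apply: (@le_lt_trans _ _ (M%:E * vol S)%E); last first.
    by apply: lte_mul_pinfty => //; rewrite lee_fin mulr_ge0// powR_ge0.
  apply: ge0_integral_le_cst => // x Sx; rewrite lee_fin (le_trans (gdle x (SC x Sx)))//.
  rewrite ler_wpM2l ?powR_ge0//; apply: le_powR_neg => //.
    by rewrite mulr_ge0// ltW.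
  by apply: mP; exact: SC.
have [K K0 KP] : exists2 K : R, 0 <= K & forall r A, 0 < r -> measurable A -> A `<=` C ->
    (vol (A `&` [set x | (`|g x| < r)%R]) <= (K * r)%:E)%E.
  apply: (compact_sublevel_le gdg cg cdg mg cC) => x /C0 x0; right.
  exact: (exists_partial_neq0_off0 gdg w0 qh crit x0).
apply: (@le_lt_trans _ _ (((kappa * B) `^ p)%:E *
    \int[lebesgue_rV n]_(x in S) (`|g x| `^ (- (p * (kappa + 1))))%:E)%E).
  have mh := measurable_norm_powR mg (- (p * (kappa + 1))).
  rewrite -(ge0_integralZl _ mS) ?lee_fin ?powR_ge0//; last exact: measurable_funTS.
  apply: ge0_le_integral => //.
  - by move=> x _; exact: G0.
  - exact: measurable_funTS.
  - by apply: measurable_funTS; exact: measurable_funeM.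
  - by move=> x Sx; rewrite -EFinM lee_fin; apply: gdle; exact: SC.
apply: lte_mul_pinfty; rewrite ?lee_fin ?powR_ge0//.
apply: (integral_norm_powR_lty mg mS Soo K0); last by rewrite mulr_gt0.
by move=> r r0; apply: KP.
Qed.

Lemma grad_Lp_near0_sufficient p : 0 < p ->
  p < (wsum w)%:R / (kappa * d%:R + (wmax w)%:R) ->
  zeros_trivial g \/ p * (kappa + 1) < 1 -> grad_Lp_near0 g kappa p.
Proof.
move=> p0 pA zp; apply/(grad_Lp_near0P gdg mg mdg kappa0 p0).
exists (wbox w 1); split; [exact: wbox1_nbhs|exact: measurable_wbox|].
have mG := measurable_grad_density mg mdg kappa p.
have G0 := grad_density_ge0 g dg kappa p.
have d0 : (0 < d)%N by exact: leq_trans wmd.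
have den0 : 0 < kappa * d%:R + (wmax w)%:R.
  by rewrite ltr_wpDr// mulr_gt0// ltr0n.
have fin := grad_density_shell_lty p0 zp.
have Ioo : (\int[lebesgue_rV n]_(x in wbox w 1%R `\ 0%R) (gd p x)%:E < +oo)%E.
  apply: (integral_wbox_lty w0 (alpha := p * (kappa * d%:R + (wmax w)%:R)) mG G0 _ _ fin).
    by rewrite -ltr_pdivlMr.
  move=> eps x e01; rewrite -EFinM lee_fin; apply: grad_density_dil => //; exact: ltW.
have m10 : measurable (wbox w 1 `\ (0 : 'rV[R]_n)).
  rewrite -(bigcup_wbox w0); apply: bigcupT_measurable => k.
  by apply: measurableD; exact: measurable_wbox.
rewrite (ge0_integral_setD (lebesgue_rV n) mG G0 m10 (measurable_wbox w 1)).
  rewrite [X in (_ + X)%E]integral0_eq ?adde0// => x [x1 nx] /=.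
  rewrite grad_density0 ?gt_eqF//.
  by have -> : x = 0 by apply: contrapT => x0; apply: nx; split.
exact: subDsetl.
Qed.

(** The minorant is the partial derivative of maximal weight: its density is homogeneous of degree
    -p(kappa d + w_max), and positive near a point where g and this derivative are both nonzero. *)
Lemma grad_Lp_near0_weights p : 0 < p -> grad_Lp_near0 g kappa p ->
  p < (wsum w)%:R / (kappa * d%:R + (wmax w)%:R).
Proof.
move=> p0 /(grad_Lp_near0P gdg mg mdg kappa0 p0)[U [U0 mU Uoo]].
have mG := measurable_grad_density mg mdg kappa p.
have G0 := grad_density_ge0 g dg kappa p.
have d0 : (0 < d)%N by exact: leq_trans wmd.
have den0 : 0 < kappa * d%:R + (wmax w)%:R.
  by rewrite ltr_wpDr// mulr_gt0// ltr0n.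
rewrite ltNge; apply/negP; rewrite ler_pdivrMr// => pA.
have [r /andP[r0 _] rU] := nbhs0_wbox w0 U0.
have [i wi] := exists_wmax w n0.
have [y [gy dgy]] := exists_partial_neq0 gdg dep i.
have mP := measurable_partial_density mg mdg kappa i p.
have P0 := partial_density_ge0 g dg kappa i p.
apply: (@integral_wbox_infty _ _ w w0 (EFin \o pd i p) _ r y mP P0 pA) => //.
- by move=> eps x e0; rewrite -EFinM /= partial_density_dil// wi.
- by apply/eqP => y0; move: gy; rewrite y0 g00 eqxx.
- have ng : \forall z \near y, g z != 0.
    by have /cvgr_neq0 := @cg y; exact.
  have nd : \forall z \near y, dg i z != 0.
    by have /cvgr_neq0 := @cdg i y; exact.
  near=> z; rewrite /= lte_fin powR_gt0// mulr_gt0 ?normr_gt0//; last by near: z.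
  by rewrite mulr_gt0// powR_gt0// normr_gt0; near: z.
- have mW := measurable_wbox w r.
  apply: (@le_lt_trans _ _ (\int[lebesgue_rV n]_(x in wbox w r) (gd p x)%:E)%E).
    apply: ge0_le_integral => //.
    + exact: measurable_funTS.
    + exact: measurable_funTS.
    + by move=> x _; rewrite lee_fin; apply: partial_density_le => //; exact: ltW.
  apply: le_lt_trans Uoo; apply: ge0_subset_integral => //.
    exact: measurable_funTS.
  by move=> x _; exact: G0.
Unshelve. all: by end_near. Qed.

Lemma exists_nearby_zero U : zeros_nontrivial g -> nbhs (0 : 'rV[R]_n) U ->
  exists x, [/\ U x, g x = 0 & x != 0].
Proof.
move=> znt U0; have [_ nsub] := znt U U0.
apply: contrapT => nx; apply: nsub => x [gx Ux] /=; apply: contrapT => x0.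
by apply: nx; exists x; split => //; exact/eqP.
Qed.

Lemma zeros_trivial_or : zeros_trivial g \/ zeros_nontrivial g.
Proof.
have [|nzt] := pselect (zeros_trivial g); [by left|right => U U0].
split; first by move=> x ->; split; [exact: g00|exact: nbhs_singleton].
by move=> sub; apply: nzt; exists U => //; apply/seteqP; split => // x ->;
  split; [exact: g00|exact: nbhs_singleton].
Qed.

(** Near the origin lies a zero x0 != 0, which is noncritical. Around it, off the zeros of g, the
    density is at least (kappa c)^p |g|^(-p(kappa+1)), which is not integrable once p(kappa+1) >=
    1. *)
Lemma grad_Lp_near0_zeros p : 0 < p -> zeros_nontrivial g ->
  grad_Lp_near0 g kappa p -> p < 1 / (kappa + 1).
Proof.
move=> p0 znt /(grad_Lp_near0P gdg mg mdg kappa0 p0)[U [U0 mU Uoo]].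
have mG := measurable_grad_density mg mdg kappa p.
have G0 := grad_density_ge0 g dg kappa p.
have kap1 : 0 < kappa + 1 by rewrite addr_gt0.
rewrite ltNge; apply/negP; rewrite ler_pdivrMr// => p1.
have [r /andP[r0 _] rU] := nbhs0_wbox w0 U0.
have W0 : nbhs (0 : 'rV[R]_n) (wbox w r).
  by apply: wbox_nbhs; apply/wboxP => i; rewrite mxE normr0 exprn_gt0.
have [x0 [x0r gx0 x00]] := exists_nearby_zero znt W0.
have [j dgx0] := exists_partial_neq0_off0 gdg w0 qh crit x00.
pose c := `|dg j x0| / 2.
have c0 : 0 < c by rewrite divr_gt0// normr_gt0.
have : nbhs x0 (wbox w r `&` [set y | c < `|dg j y|]).
  apply: filterI; first exact: wbox_nbhs.
  have : (fun y => `|dg j y|) @ x0 --> `|dg j x0|.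
    by apply: continuous_comp; [exact: cdg|exact: norm_continuous].
  by move=> /cvgr_gt; apply; rewrite /c; have := dgx0; rewrite -normr_gt0; lra.
move=> /nbhs_ballP[e /= e0 eP].
have mB := measurable_ball_rV x0 e0.
have mP := measurable_partial_density mg mdg kappa j p.
have P0 := partial_density_ge0 g dg kappa j p.
have kc0 : 0 < kappa * c by rewrite mulr_gt0.
apply: (@integral_near_zero_infty _ _ g dg gdg cg cdg mg x0 j (ball x0 e)
  (EFin \o pd j p) ((kappa * c) `^ p) (p * (kappa + 1))) => //.
- exact: nbhsx_ballx.
- exact: powR_gt0.
- move=> x /eP[_ /= cx] gx; rewrite lee_fin -mulrN (mulrC p) powRrM.
  rewrite -powRM ?powR_ge0 ?(ltW kc0)//; apply: ge0_ler_powR; first exact: ltW.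
  + by rewrite nnegrE; apply: mulr_ge0; [exact: ltW|exact: powR_ge0].
  + rewrite nnegrE; apply: mulr_ge0 => //.
    by apply: mulr_ge0; [exact: ltW|exact: powR_ge0].
  rewrite mulrAC; apply: ler_wpM2l; last exact: ltW.
  by apply: mulr_ge0; [exact: ltW|exact: powR_ge0].
- apply: (@le_lt_trans _ _ (\int[lebesgue_rV n]_(x in ball x0 e) (gd p x)%:E)%E).
    apply: ge0_le_integral => //.
    + exact: measurable_funTS.
    + exact: measurable_funTS.
    + by move=> x _; rewrite lee_fin; apply: partial_density_le => //; exact: ltW.
  apply: le_lt_trans Uoo; apply: ge0_subset_integral => //.
  + exact: measurable_funTS.
  + by move=> x _; exact: G0.
  + by move=> x /eP[/rU].
Qed.

(** Replaces an integrand that may be +oo by a real one that never exceeds it; its finite integral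
    is all that the necessary conditions on c require. *)
Let rlct0_integral (c : R) :
  integrable_near0 setT (fun x => ((`|g x| `^ c)%:E^-1)%E) ->
  exists U, [/\ nbhs (0 : 'rV[R]_n) U, measurable U &
    (\int[lebesgue_rV n]_(x in U) (`|g x| `^ (- c))%:E < +oo)%E].
Proof.
move=> [U [U0 mU]]; rewrite setIT => /integrableP[mh hoo]; exists U; split => //.
apply: le_lt_trans hoo; apply: ge0_le_integral => //.
- by apply: measurable_funTS; exact: measurable_norm_powR.
- exact: measurableT_comp.
- move=> x _; rewrite gee0_abs ?inve_ge0 ?lee_fin ?powR_ge0//.
  rewrite inver; case: ifPn => [_|_]; first by rewrite leey.
  by rewrite lee_fin powRN.
Qed.

Lemma rlct0_weights (c : R) : 0 < c ->
  integrable_near0 setT (fun x => ((`|g x| `^ c)%:E^-1)%E) ->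
  c < (wsum w)%:R / d%:R.
Proof.
move=> c0 /rlct0_integral[U [U0 mU Uoo]].
have d0 : 0 < d%:R :> R by rewrite ltr0n; exact: leq_trans wmd.
have mh := measurable_norm_powR mg (- c).
rewrite ltNge; apply/negP; rewrite ler_pdivrMr// => cd.
have [r /andP[r0 _] rU] := nbhs0_wbox w0 U0.
have [y [gy _]] := exists_partial_neq0 gdg dep (Ordinal n0).
have h0 x : (0 <= (`|g x| `^ (- c))%:E)%E by rewrite lee_fin powR_ge0.
apply: (@integral_wbox_infty _ _ w w0 _ _ r y mh h0 cd) => //.
- move=> eps x e0; rewrite -EFinM norm_g_dil//.
  by congr ((_ `^ _ * _)%:E); ring.
- by apply/eqP => y0; move: gy; rewrite y0 g00 eqxx.
- have ng : \forall z \near y, g z != 0 by have /cvgr_neq0 := @cg y; exact.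
  by near=> z; rewrite /= lte_fin powR_gt0// normr_gt0; near: z.
- apply: le_lt_trans Uoo; apply: ge0_subset_integral => //.
  + exact: measurable_wbox.
  + exact: measurable_funTS.
Unshelve. all: by end_near. Qed.

Lemma rlct0_zeros (c : R) : zeros_nontrivial g ->
  integrable_near0 setT (fun x => ((`|g x| `^ c)%:E^-1)%E) -> c < 1.
Proof.
move=> znt /rlct0_integral[U [U0 mU Uoo]].
have mh := measurable_norm_powR mg (- c).
have h0 x : (0 <= (`|g x| `^ (- c))%:E)%E by rewrite lee_fin powR_ge0.
rewrite ltNge; apply/negP => c1.
have [r /andP[r0 _] rU] := nbhs0_wbox w0 U0.
have W0 : nbhs (0 : 'rV[R]_n) (wbox w r).
  by apply: wbox_nbhs; apply/wboxP => i; rewrite mxE normr0 exprn_gt0.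
have [x0 [x0r gx0 x00]] := exists_nearby_zero znt W0.
have [j dgx0] := exists_partial_neq0_off0 gdg w0 qh crit x00.
have mW := measurable_wbox w r.
apply: (@integral_near_zero_infty _ _ g dg gdg cg cdg mg x0 j (wbox w r)
  _ 1 c gx0 dgx0 _ mW mh h0 c1) => //.
- exact: wbox_nbhs.
- by move=> x _ _; rewrite mul1r.
- apply: le_lt_trans Uoo; apply: ge0_subset_integral => //.
  exact: measurable_funTS.
Qed.

Let A : R := (wsum w)%:R / (kappa * d%:R + (wmax w)%:R).

Let A_gt0 : 0 < A.
Proof.
have d0 : 0 < d%:R :> R by rewrite ltr0n; exact: leq_trans wmd.
apply: divr_gt0; last by rewrite ltr_wpDr// mulr_gt0.
by rewrite ltr0n /wsum (bigD1 (Ordinal n0))//= ltn_addr.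
Qed.

Lemma is_grad_threshold_trivial : zeros_trivial g -> is_grad_threshold g kappa A.
Proof.
move=> zt p p0; split; first exact: grad_Lp_near0_weights.
by move=> pA; apply: grad_Lp_near0_sufficient => //; left.
Qed.

Lemma is_grad_threshold_nontrivial : zeros_nontrivial g ->
  is_grad_threshold g kappa (Num.min A (1 / (kappa + 1))).
Proof.
have kap1 : 0 < kappa + 1 by rewrite addr_gt0.
move=> znt p p0; rewrite lt_min; split.
  move=> Lp; apply/andP; split; first exact: grad_Lp_near0_weights.
  exact: grad_Lp_near0_zeros.
move=> /andP[pA pk]; apply: grad_Lp_near0_sufficient => //; right.
by rewrite -ltr_pdivlMr.
Qed.

(** Thresholds are tested at positive exponents only, so nonpositive ones are indistinguishable; [t]
    > 0 excludes them. *)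
Lemma is_grad_threshold_unique (s t : R) : 0 < t ->
  is_grad_threshold g kappa s -> is_grad_threshold g kappa t -> s = t.
Proof.
move=> t0 hs ht; have st p : 0 < p -> (p < s) = (p < t).
  by move=> p0; apply/idP/idP => [/(hs p p0)/(ht p p0)|/(ht p p0)/(hs p p0)].
have [st'|ts|//] := ltgtP s t.
  (* A positive exponent below t but not below s. *)
  have m0 : 0 < Num.max s (t / 2) by rewrite lt_max (divr_gt0 t0)// orbT.
  have := st _ m0; rewrite gt_max ltxx/= gt_max st'/=.
  by move/esym; rewrite ltr_pdivrMr// ltr_pMr// ltr1n.
by have := st _ t0; rewrite ts ltxx.
Qed.

Lemma rlct0_le_weights : (rlct0 g <= ((wsum w)%:R / d%:R)%:E)%E.
Proof.
apply: ge_ereal_sup => _ [c [c0 ic] <-]; rewrite lee_fin ltW//.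
exact: rlct0_weights.
Qed.

Lemma rlct0_le1 : zeros_nontrivial g -> (rlct0 g <= 1%:E)%E.
Proof.
move=> znt; apply: ge_ereal_sup => _ [c [c0 ic] <-]; rewrite lee_fin ltW//.
exact: rlct0_zeros.
Qed.

Let pbar : \bar R := (rlct0 g * ((kappa + 1)^-1)%:E)%E.

Let pbar_le (b : R) : (rlct0 g <= b%:E)%E -> (pbar <= (b / (kappa + 1))%:E)%E.
Proof.
move=> rb; rewrite /pbar EFinM lee_wpmul2r// lee_fin invr_ge0 ltW//.
by rewrite addr_gt0.
Qed.

(** With |w| cancelled, the bound reads kappa d + w_max < d (kappa + 1). It holds whatever the zero
    set, so strictness in the second case only requires that the minimum be [A]. *)
Let pbar_lt : (pbar < A%:E)%E.
Proof.
have kap1 : 0 < kappa + 1 by rewrite addr_gt0.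
have d0 : 0 < d%:R :> R by rewrite ltr0n; exact: leq_trans wmd.
apply: (le_lt_trans (pbar_le rlct0_le_weights)); rewrite lte_fin -mulrA -invfM.
have W0 : 0 < (wsum w)%:R :> R by rewrite ltr0n /wsum (bigD1 (Ordinal n0))//= ltn_addr.
rewrite /A ltr_pM2l// ltf_pV2 ?posrE ?mulr_gt0//; last by rewrite ltr_wpDr// mulr_gt0.
by rewrite mulrDr mulr1 mulrC ltrD2l ltr_nat.
Qed.

Theorem grad_threshold_quasi_homogeneous :
  [/\ (exists pstar : R, is_grad_threshold g kappa pstar),
      (rlct0 g <= ((wsum w)%:R / d%:R)%:E)%E,
      (pbar <= ((wsum w)%:R / d%:R / (kappa + 1))%:E)%E &
      forall pstar : R, is_grad_threshold g kappa pstar ->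
        [/\ zeros_trivial g -> pstar = A,
            zeros_nontrivial g -> pstar = Num.min A (1 / (kappa + 1)),
            (pbar <= pstar%:E)%E,
            zeros_trivial g -> (pbar < pstar%:E)%E &
            zeros_nontrivial g -> A < 1 / (kappa + 1) ->
              (pbar < pstar%:E)%E]].
Proof.
have kap1 : 0 < kappa + 1 by rewrite addr_gt0.
have m0 : 0 < Num.min A (1 / (kappa + 1)) by rewrite lt_min A_gt0 divr_gt0.
split.
- have [zt|znt] := zeros_trivial_or.
    by exists A; exact: is_grad_threshold_trivial.
  by exists (Num.min A (1 / (kappa + 1))); exact: is_grad_threshold_nontrivial.
- exact: rlct0_le_weights.
- exact/pbar_le/rlct0_le_weights.
move=> s hs.
have sT : zeros_trivial g -> s = A.
  by move=> zt; apply: is_grad_threshold_unique hs _ => //; exact: is_grad_threshold_trivial.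
have sN : zeros_nontrivial g -> s = Num.min A (1 / (kappa + 1)).
  by move=> znt; apply: is_grad_threshold_unique hs _ => //; exact: is_grad_threshold_nontrivial.
split => //.
- have [zt|znt] := zeros_trivial_or; first by rewrite sT// ltW.
  (* [pbar] is at most the second term of the minimum because rlct is at most 1 when g has nonzero
     zeros near the origin. *)
  rewrite sN// EFin_min le_min (ltW pbar_lt)/=; apply: pbar_le; exact: rlct0_le1.
- by move=> /sT ->.
- by move=> /sN -> /ltW /min_idPl ->.
Qed.

End threshold.

(** * Application to polynomials *)

Theorem proposition2p18 (R : realType) (n : nat) (f : mpoly.mpoly n R)
    (w : 'I_n -> nat) (d : nat) (kappa : R) :
  (0 < n)%N ->
  (forall i, (0 < w i)%N) ->
  quasi_homogeneous (peval f) w d ->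
  isolated_critical_point (peval f) 0 ->
  (forall i, depends_on (peval f) i) ->
  0 < kappa ->
  let A : R := (wsum w)%:R / (kappa * d%:R + (wmax w)%:R) in
  let pbar : \bar R := (rlct0 (peval f) * ((kappa + 1)^-1)%:E)%E in
  [/\ (exists pstar : R, is_grad_threshold (peval f) kappa pstar),
      (rlct0 (peval f) <= ((wsum w)%:R / d%:R)%:E)%E,
      (pbar <= ((wsum w)%:R / d%:R / (kappa + 1))%:E)%E &
      forall pstar : R, is_grad_threshold (peval f) kappa pstar ->
        [/\ zeros_trivial (peval f) -> pstar = A,
            zeros_nontrivial (peval f) -> pstar = Num.min A (1 / (kappa + 1)),
            (pbar <= pstar%:E)%E,
            zeros_trivial (peval f) -> (pbar < pstar%:E)%E &
            zeros_nontrivial (peval f) -> A < 1 / (kappa + 1) ->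
              (pbar < pstar%:E)%E]].
Proof.
move=> n0 w0 qh crit dep kappa0.
exact: (grad_threshold_quasi_homogeneous (has_partials_peval f)
  (@continuous_peval _ _ f) (fun i => @continuous_peval _ _ (mderiv i f))
  (measurable_peval f) (fun i => measurable_peval (mderiv i f))
  n0 w0 qh crit dep kappa0).
Qed.
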